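(* Let $1\le M\le N$ and let $\beta\ge\lambda_1\ge\lambda_2\ge\cdots\ge\lambda_M\ge\alpha$ be ordered real random variables whose joint p.d.f. on the ordered region $\beta\ge x_1\ge\cdots\ge x_M\ge\alpha$ is $$f_{\boldsymbol\lambda}(\boldsymbol x)=K\,\det\boldsymbol\Phi(\boldsymbol x)\,\det\boldsymbol\Psi(\boldsymbol x)\prod_{i=1}^{M}\xi(x_i),$$ where $K$ is the normalizing constant, $\xi$ is a function, $\boldsymbol\Phi(\boldsymbol x)\in\mathbb C^{M\times M}$ has entries $\Phi_i(x_j)$, and $\boldsymbol\Psi(\boldsymbol x)\in\mathbb C^{N\times N}$ has entries $\Psi_i(x_j)$ for $j\le M$ and constants $\bar\Psi_{i,j}$ for $M<j\le N$. Let $1\le\ell\le M$ and let $\varphi$ be an arbitrary function. Then $$\mathbb E\{\varphi(\lambda_\ell)\}=c(\ell)\,K\,\mathcal I,\qquad c(\ell)=\frac{1}{(\ell-1)!\,(M-\ell)!},$$ where $$\mathcal I=\int_\alpha^\beta\varphi(x_\ell)\,\mathcal T(\boldsymbol A(x_\ell))\,dx_\ell=\sum_{\boldsymbol\mu}\operatorname{sgn}(\boldsymbol\mu)\sum_{\boldsymbol\alpha}\operatorname{sgn}(\boldsymbol\alpha)\int_\alpha^\beta\varphi(x_\ell)\prod_{k=1}^N a_{\mu_k,\alpha_k,k}(x_\ell)\,dx_\ell,$$ the sums are over all permutations $\boldsymbol\mu,\boldsymbol\alpha$ of $\{1,\dots,N\}$, and the $N\times N\times N$ tensor $\boldsymbol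 A(x_\ell)$ has elements $$a_{i,j,k}(x_\ell)=\begin{cases}\displaystyle\int_{x_\ell}^{\beta}\varsigma_i(x)\Psi_j(x)\,dx & k<\ell\le M\\ \varsigma_i(x_\ell)\Psi_j(x_\ell)& k=\ell\le M\\ \displaystyle\int_\alpha^{x_\ell}\varsigma_i(x)\Psi_j(x)\,dx & \ell<k\le M\\ 0& k>M,\ i<k\\ \bar\Psi_{j,k}& k>M,\ i\ge k,\end{cases}\qquad \varsigma_i(x)=\begin{cases}\Phi_i(x)\xi(x)& i\le M\\ \xi(x)& i>M.\end{cases}$$
   Context: For a rank-3 tensor $\boldsymbol A=\{a_{i,j,k}\}_{i,j,k=1,\dots,N}$ the pseudo-determinant is $\mathcal T(\boldsymbol A)=\sum_{\boldsymbol\mu}\operatorname{sgn}(\boldsymbol\mu)\sum_{\boldsymbol\alpha}\operatorname{sgn}(\boldsymbol\alpha)\prod_{k=1}^N a_{\mu_k,\alpha_k,k}$, where both sums run over all permutations of $\{1,\dots,N\}$. The endpoints $\alpha<\beta$ may be infinite. The scalar functions $\Phi_i$ ($1\le i\le M$), $\Psi_i$ ($1\le i\le N$), $\xi$, $\varphi$ and the constants $\bar\Psi_{i,j}$ are arbitrary, subject to the function $f_{\boldsymbol\lambda}(\boldsymbol x)=K\,\det\boldsymbol\Phi(\boldsymbol x)\,\det\boldsymbol\Psi(\boldsymbol x)\prod_{i=1}^{M}\xi(x_i)$ being a p.d.f. on the ordered region $\beta\ge x_1\ge\cdots\ge x_M\ge\alpha$ and to the integrals appearing being well defined (absolutely convergent).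 *)

(* Defs.v *)
From HB Require Import structures.
From mathcomp Require Import all_boot all_order all_algebra all_fingroup.
From mathcomp Require Import all_classical all_reals all_analysis.
From mathcomp Require Import complex.

Set Implicit Arguments.
Unset Strict Implicit.
Unset Printing Implicit Defensive.

Import Order.TTheory GRing.Theory Num.Theory.
Import numFieldNormedType.Exports.

Local Open Scope classical_set_scope.
Local Open Scope ring_scope.
Local Open Scope complex_scope.

Definition cintegrable d (T : measurableType d) (R : realType)
    (mu : {measure set T -> \bar R}) (D : set T) (f : T -> R[i]) : Prop :=
  mu.-integrable D (EFin \o (fun x => complex.Re (f x))) /\
  mu.-integrable D (EFin \o (fun x => complex.Im (f x))).

Definition cintegral d (T : measurableType d) (R : realType)
    (mu : {measure set T -> \bar R}) (D : set T) (f : T -> R[i]) : R[i] :=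
  (\int[mu]_(x in D) complex.Re (f x)) +i* (\int[mu]_(x in D) complex.Im (f x)).

Definition cexpectation d (T : measurableType d) (R : realType)
    (P : probability T R) (X : T -> R[i]) : R[i] :=
  fine 'E_P[fun w => complex.Re (X w)] +i* fine 'E_P[fun w => complex.Im (X w)].

(* measurableTypeR R is R carrying the sigma-algebra on which lebesgue_measure is
   defined; its measurable sets are those of the canonical structure of R. *)
Definition cons_pair (R : realType) n (p : measurableTypeR R * n.-tuple R) :
    n.+1.-tuple R :=
  [tuple of (p.1 : R) :: p.2].

Lemma measurable_cons_pair (R : realType) n :
  measurable_fun [set: measurableTypeR R * n.-tuple R] (@cons_pair R n).
Proof.
apply: (@measurable_cons _ _ _ _ fst n snd) => //.
Qed.

(* Lebesgue measure on R^n, with R^n the measurable space n.-tuple R. *)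
Fixpoint lebesgue_tuple (R : realType) n : set (n.-tuple R) -> \bar R :=
  if n is m.+1 then
    pushforward (@lebesgue_measure R \x @lebesgue_tuple R m)%E (@cons_pair R m)
  else \d_([tuple] : 0.-tuple R).
Arguments lebesgue_tuple : clear implicits.

Section lebesgue_tuple_measure.
Variable R : realType.
Local Open Scope ereal_scope.

Section step.
Variables (n : nat) (m : {sigma_finite_measure set (n.-tuple R) -> \bar R}).

Definition lebesgue_cons : set (n.+1.-tuple R) -> \bar R :=
  pushforward (@lebesgue_measure R \x m) (@cons_pair R n).

Let pm : {measure set (measurableTypeR R * n.-tuple R)%type -> \bar R} :=
  (@lebesgue_measure R \x m).

Let mcons : measurable_fun [set: measurableTypeR R * n.-tuple R] (@cons_pair R n) :=
  @measurable_cons_pair R n.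

Let lebesgue_cons0 : lebesgue_cons set0 = 0.
Proof. by rewrite /lebesgue_cons /pushforward preimage_set0 measure0. Qed.

Let lebesgue_cons_ge0 A : 0 <= lebesgue_cons A.
Proof. exact: (measure_ge0 pm). Qed.

Let lebesgue_cons_sigma_additive : semi_sigma_additive lebesgue_cons.
Proof.
move=> F mF tF mUF; rewrite /lebesgue_cons /pushforward preimage_bigcup.
apply: (@measure_semi_sigma_additive _ _ _ pm) => //.
- by move=> i; rewrite -[X in measurable X]setTI; exact: mcons.
- apply/trivIsetP => /= i j _ _ ij; rewrite -preimage_setI.
  by move/trivIsetP : tF => -> //; rewrite preimage_set0.
- by rewrite -preimage_bigcup -[X in measurable X]setTI; exact: mcons.
Qed.

HB.instance Definition _ := isMeasure.Build _ _ _ lebesgue_cons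
  lebesgue_cons0 lebesgue_cons_ge0 lebesgue_cons_sigma_additive.

Let uncons (t : n.+1.-tuple R) : measurableTypeR R * n.-tuple R :=
  (tnth t ord0, [tuple of behead t]).

Let measurable_uncons : measurable_fun [set: n.+1.-tuple R] uncons.
Proof.
apply: measurable_fun_pair; [exact: measurable_tnth|exact: measurable_behead].
Qed.

Let uncons_cons p : uncons (cons_pair p) = p.
Proof.
by case: p => x t; rewrite /uncons /cons_pair; congr pair; exact/val_inj.
Qed.

Let lebesgue_cons_sigma_finite : sigma_finite setT lebesgue_cons.
Proof.
have /sigma_finiteP[F [TF ndF Foo]] := sigma_finiteT (@lebesgue_measure R).
have /sigma_finiteP[G [TG ndG Goo]] := sigma_finiteT m.
exists (fun i => uncons @^-1` (F i `*` G i)).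
  rewrite -preimage_bigcup -[LHS](preimage_setT uncons); congr preimage.
  rewrite -setXTT TF TG; apply/seteqP; split=> [[x y] /= [[i _ Fx] [k _ Gy]]|].
    exists (maxn i k) => //; split.
    - by move: x Fx; exact/subsetPset/ndF/leq_maxl.
    - by move: y Gy; exact/subsetPset/ndG/leq_maxr.
  by move=> [x y] [i _ [Fx Gy]]; split; exists i.
move=> i; have [mF Fi] := Foo i; have [mG Gi] := Goo i; split.
  rewrite -[X in measurable X]setTI.
  by apply: measurable_uncons => //; exact: measurableX.
rewrite /lebesgue_cons /pushforward -comp_preimage.
rewrite (_ : _ \o _ = id) ?preimage_id; last by apply/funext => p /=.
by rewrite product_measure1E// lte_mul_pinfty// ge0_fin_numE.
Qed.

HB.instance Definition _ := Measure_isSigmaFinite.Build _ _ _ lebesgue_cons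
  lebesgue_cons_sigma_finite.

End step.

Lemma lebesgue_tuple_ex n :
  exists m : {sigma_finite_measure set (n.-tuple R) -> \bar R},
    m = lebesgue_tuple R n :> (set _ -> \bar R).
Proof.
elim: n => [|n [m mE]].
  by exists (\d_([tuple] : 0.-tuple R)).
by exists (lebesgue_cons m); rewrite /= -mE.
Qed.

Section instances.
Variable n : nat.

Let lebesgue_tuple0 : lebesgue_tuple R n set0 = 0.
Proof. by have [m <-] := lebesgue_tuple_ex n; rewrite measure0. Qed.

Let lebesgue_tuple_ge0 A : 0 <= lebesgue_tuple R n A.
Proof. by have [m <-] := lebesgue_tuple_ex n. Qed.

Let lebesgue_tuple_sigma_additive : semi_sigma_additive (lebesgue_tuple R n).
Proof.
by have [m <-] := lebesgue_tuple_ex n; exact: measure_semi_sigma_additive.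
Qed.

HB.instance Definition _ := isMeasure.Build _ _ _ (lebesgue_tuple R n)
  lebesgue_tuple0 lebesgue_tuple_ge0 lebesgue_tuple_sigma_additive.

Let lebesgue_tuple_sigma_finite : sigma_finite setT (lebesgue_tuple R n).
Proof. by have [m <-] := lebesgue_tuple_ex n; exact: sigma_finiteT. Qed.

HB.instance Definition _ := Measure_isSigmaFinite.Build _ _ _
  (lebesgue_tuple R n) lebesgue_tuple_sigma_finite.

End instances.

Lemma lebesgue_tuple_box n (A : 'I_n -> set R) : (forall i, measurable (A i)) ->
  lebesgue_tuple R n [set x | forall i, A i (tnth x i)] =
  \prod_(i < n) lebesgue_measure (A i).
Proof.
elim: n A => [|n IH] A mA.
  by rewrite big_ord0 /= diracE mem_set //= => -[].
rewrite big_ord_recl -IH//=.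
rewrite -product_measure1E; [|exact: mA|]; last first.
  rewrite (_ : [set x | _] =
      \bigcap_(i in [set: 'I_n]) ((fun x => tnth x i) @^-1` A (lift ord0 i))).
    apply: fin_bigcap_measurable => // i _.
    by rewrite -[X in measurable X]setTI; exact: measurable_tnth.
  by apply/seteqP; split => [x h i _|x h i]; exact: h.
congr ((lebesgue_measure \x _) _).
apply/seteqP; split => [[x t] /= h|[x t] /= [hx ht] i].
- by split=> [|i]; [exact: (h ord0)|have := h (lift ord0 i); rewrite tnthS].
- by case: (unliftP ord0 i) => [j ->|->//]; rewrite tnthS; exact: ht.
Qed.

End lebesgue_tuple_measure.

(* The law of (X_i)_i has density f on D and does not charge the complement of D;
   taking B = setT shows that f integrates to 1 over D. *)
Definition is_joint_pdf_on d (T : measurableType d) (R : realType)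
    (P : probability T R) n (X : 'I_n -> {RV P >-> R})
    (D : set (n.-tuple R)) (f : n.-tuple R -> R) : Prop :=
  [/\ measurable_fun D f,
      (forall x, D x -> 0 <= f x) &
      forall B : set (n.-tuple R), measurable B ->
        P [set w | B [tuple X i w | i < n]] =
        (\int[lebesgue_tuple R n]_(x in B `&` D) (f x)%:E)%E].

Arguments is_joint_pdf_on {d T R} P {n} X D f.

Definition ordered_region (R : realType) (alpha beta : \bar R) n :
    set (n.-tuple R) :=
  [set x | (forall i, (alpha <= (tnth x i)%:E <= beta)%E) /\
           (forall i j : 'I_n, (i <= j)%N -> tnth x j <= tnth x i)].

Definition interval_between (R : realType) (a b : \bar R) : set R :=
  [set x | (a <= x%:E <= b)%E].

Definition tensor3 (C : Type) n := 'I_n -> 'I_n -> 'I_n -> C.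

Definition pseudo_det (C : comNzRingType) n (A : tensor3 C n) : C :=
  \sum_(mu : 'S_n) (-1) ^+ mu *
    \sum_(al : 'S_n) (-1) ^+ al * \prod_(k < n) A (mu k) (al k) k.

(* Indices are 0-based: the mathematical index i in {1, ..., n} is the ordinal of
   value i - 1 in 'I_n. In Psi_mx and varsigma, insub is defined exactly on the
   indices below M, i.e. on the mathematical indices <= M. *)

Section ensemble.
Variables (R : realType) (M N : nat).
Variables (Phi : 'I_M -> R -> R[i]) (Psi : 'I_N -> R -> R[i]).
Variables (Psibar : 'I_N -> 'I_N -> R[i]) (xi : R -> R[i]).

Definition Phi_mx (x : M.-tuple R) : 'M[R[i]]_M :=
  \matrix_(i, j) Phi i (tnth x j).

Definition Psi_mx (x : M.-tuple R) : 'M[R[i]]_N :=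
  \matrix_(i, j)
    if (insub (val j) : option 'I_M) is Some jM then Psi i (tnth x jM)
    else Psibar i j.

Definition varsigma (i : 'I_N) (x : R) : R[i] :=
  if (insub (val i) : option 'I_M) is Some iM then Phi iM x * xi x else xi x.

Variables (alpha beta : \bar R) (l : 'I_M).

Definition A_tensor (x : R) : tensor3 R[i] N := fun i j k =>
  if (k < M)%N then
    if (k < l)%N then
      cintegral lebesgue_measure (interval_between x%:E beta)
        (fun y => varsigma i y * Psi j y)
    else if k == l :> nat then varsigma i x * Psi j x
    else
      cintegral lebesgue_measure (interval_between alpha x%:E)
        (fun y => varsigma i y * Psi j y)
  else if (i < k)%N then 0 else Psibar j k.

End ensemble.

(* Main.v *)
Require Import Defs.
From HB Require Import structures.
From mathcomp Require Import all_boot all_order all_algebra all_fingroup.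
From mathcomp Require Import all_classical all_reals all_analysis.
From mathcomp Require Import measurable_realfun.
From mathcomp Require Import complex.

(** Fix the value [x] of the coordinate [l].  The theorem follows from the
    marginal density of the [l]-th ordered variable, obtained by integrating
    the joint density over the remaining [n = M - 1] coordinates [y], subject to
    the ordering.

    The joint density is [K] times [det_pair], a product of two [N * N]
    determinants: the second is the given one, and the first extends
    [\det Phi * \prod xi] by a lower unitriangular block ([det_varsigma_mx]).
    That block accounts for the zeros of the tensor and for the rows
    [varsigma i] with [i >= M].  Permuting the variables changes the
    sign of both determinants, so [det_pair] is symmetric, and it vanishes as
    soon as two variables coincide.

    By symmetry the ordered domain of [y] can be replaced by a product domain:
    the box in which the coordinates before [l] lie in [[x, beta]] and the
    others in [[alpha, x]], with no order inside the two groups.  A point of the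
    box without ties is sorted by exactly one of the [l! (n - l)!] permutations
    that preserve the two groups ([card_sorting_perm]), and ties do not matter
    since [det_pair] vanishes there; hence [sum_ordered_slice], and the factor
    [c(l)].  On the box the integral is elementary: expanding both determinants
    gives products of functions of one variable, which Fubini's theorem turns
    into products of integrals ([cintegral_box_prod]); these are the terms of
    the pseudo-determinant ([cintegral_slice]).  So for every [x] strictly
    between [alpha] and [beta] the marginal density at [x] is
    [c(l) * K * pseudo_det (A x)] ([slice_density]).

    The last step integrates [phi] against this density.  The difficulty
    is that only [phi] of the random variable, and [phi] times the density, are
    known to be measurable.  Dividing the latter by the density recovers a measurable
    function that agrees with [phi] almost surely ([expectation_density]). *)

Import Order.TTheory GRing.Theory Num.Theory.
Import numFieldNormedType.Exports.
Local Open Scope classical_set_scope.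
Local Open Scope ring_scope.
Local Open Scope complex_scope.

Set Implicit Arguments.
Unset Strict Implicit.
Unset Printing Implicit Defensive.

(** * Lebesgue measure on tuples: boxes, permutations, inserted coordinates *)

Definition perm_tuple (T : Type) n (p : 'S_n) (x : n.-tuple T) : n.-tuple T :=
  [tuple tnth x (p i) | i < n].

Definition box (T : Type) n (A : 'I_n -> set T) : set (n.-tuple T) :=
  [set x | forall i, A i (tnth x i)].

Lemma measurable_tnth_preimage d (T : measurableType d) n (i : 'I_n) (A : set T) :
  measurable A -> measurable ((fun x : n.-tuple T => tnth x i) @^-1` A).
Proof.
by move=> mA; rewrite -[X in measurable X]setTI; exact: measurable_tnth.
Qed.

Lemma measurable_box d (T : measurableType d) n (A : 'I_n -> set T) :
  (forall i, measurable (A i)) -> measurable (box A).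
Proof.
move=> mA; rewrite (_ : box A =
  \bigcap_(i in [set: 'I_n]) ((fun x => tnth x i) @^-1` A i)).
  by apply: fin_bigcap_measurable => // i _; exact: measurable_tnth_preimage.
by apply/seteqP; split => [x h i _|x h i]; exact: h.
Qed.

Lemma measurable_perm_tuple d (T : measurableType d) n (p : 'S_n) :
  measurable_fun setT (@perm_tuple T n p).
Proof.
apply/measurable_fun_tnthP => i.
rewrite (_ : _ \o _ = fun x => tnth x (p i)); first exact: measurable_tnth.
by apply/funext => x /=; rewrite tnth_mktuple.
Qed.

Lemma measurable_tuple_box d (T : measurableType d) n :
  (measurable : set (set (n.-tuple T))) =
  <<s [set B | exists2 A : 'I_n -> set T, (forall i, measurable (A i)) & B = box A] >>.
Proof.
apply/seteqP; split; last first.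
  apply: smallest_sub; first exact: sigma_algebra_measurable.
  by move=> _ [A mA ->]; exact: measurable_box.
apply: smallest_sub; first exact: smallest_sigma_algebra.
rewrite -bigcup_seq => C [i /= _ [A mA <-]].
apply: sub_sigma_algebra; exists (fun j => if j == i then A else setT).
  by move=> j; case: ifP => // _; exact: measurableT.
rewrite setTI; apply/seteqP; split => [x /= Ax j|x /= /(_ i)]; last by rewrite eqxx.
by case: eqP => [->|].
Qed.

(** Boxes with measurable sides are stable under intersection and generate the
    sigma-algebra, and the cubes [[- k, k]^n] are boxes of finite measure that
    exhaust the space. *)
Lemma lebesgue_tuple_unique (R : realType) n
    (mu : {measure set (n.-tuple R) -> \bar R}) :
  (forall A : 'I_n -> set R, (forall i, measurable (A i)) ->
     mu (box A) = (\prod_(i < n) lebesgue_measure (A i))%E) ->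
  forall B, measurable B -> mu B = lebesgue_tuple R n B.
Proof.
move=> muE; pose g k := box (fun _ : 'I_n => [set` `[- k%:R, k%:R : R]]).
have mg k : forall i : 'I_n, measurable [set` `[- k%:R, k%:R : R]].
  by move=> i; exact: measurable_itv.
apply: (@measure_unique _ _ _ _ g (@measurable_tuple_box _ R n)).
- move=> _ _ [A mA ->] [B mB ->]; exists (fun i => A i `&` B i).
    by move=> i; exact: measurableI.
  apply/seteqP; split => [x [xA xB] i|x xAB]; first by split.
  by split => i; have [] := xAB i.
- by move=> k; exists (fun=> [set` `[- k%:R, k%:R]]).
- rewrite -subTset => x _.
  exists (\max_(i < n) (Num.trunc `|tnth x i|).+1)%N => //= i.
  rewrite /= in_itv /= -ler_norml.
  apply: (le_trans (ltW (truncnS_gt _))); rewrite ler_nat.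
  exact: (leq_bigmax i).
- move=> _ [A mA ->]; rewrite muE//.
  by rewrite -lebesgue_tuple_box.
- move=> k; rewrite muE; last exact: mg.
  set C := [set` _]; suff /andP[] : (0 <= \prod_(i < n) lebesgue_measure C < +oo)%E by [].
  apply: (big_ind (fun y : \bar R => 0 <= y < +oo)%E).
  + by rewrite lee_fin ler01 ltry.
  + move=> x y /andP[x0 xoo] /andP[y0 yoo]; rewrite mule_ge0//=.
    by rewrite lte_mul_pinfty// ge0_fin_numE.
  + move=> i _; rewrite measure_ge0/= lebesgue_measure_itv /=.
    by case: ifP => // _; rewrite -EFinB ltry.
Qed.

(** The preimage of a box under a permutation of coordinates is the box with
    permuted sides, whose measure is the same product. *)
Lemma lebesgue_tuple_perm (R : realType) n (p : 'S_n) (B : set (n.-tuple R)) :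
  measurable B ->
  lebesgue_tuple R n (@perm_tuple R n p @^-1` B) = lebesgue_tuple R n B.
Proof.
pose mp : {mfun n.-tuple R >-> n.-tuple R} :=
  HB.pack (@perm_tuple R n p) (isMeasurableFun.Build _ _ _ _ _ (@measurable_perm_tuple _ R n p)).
move=> mB.
apply: (@lebesgue_tuple_unique R n (pushforward (lebesgue_tuple R n) mp)) => //.
move=> A mA; rewrite /pushforward.
transitivity (lebesgue_tuple R n (box (fun i => A ((p^-1)%g i)))).
  congr (lebesgue_tuple R n _).
  apply/seteqP; split => x /= h i.
    by have := h ((p^-1)%g i); rewrite tnth_mktuple permKV.
  by rewrite tnth_mktuple; have := h (p i); rewrite permK.
rewrite lebesgue_tuple_box// (reindex_perm p)/=.
by apply: eq_bigr => i _; rewrite permK.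
Qed.

Lemma ge0_integral_perm_tuple (R : realType) n (p : 'S_n) (f : n.-tuple R -> \bar R) :
  measurable_fun setT f -> (forall x, 0 <= f x)%E ->
  (\int[lebesgue_tuple R n]_x f (perm_tuple p x) = \int[lebesgue_tuple R n]_x f x)%E.
Proof.
move=> mf f0.
pose mp : {mfun n.-tuple R >-> n.-tuple R} :=
  HB.pack (@perm_tuple R n p) (isMeasurableFun.Build _ _ _ _ _ (@measurable_perm_tuple _ R n p)).
transitivity (\int[pushforward (lebesgue_tuple R n) mp]_x f x)%E.
  by rewrite ge0_integral_pushforward.
by apply: eq_measure_integral => A mA _; exact: lebesgue_tuple_perm.
Qed.

Lemma ge0_integral_cons (R : realType) n (f : n.+1.-tuple R -> \bar R) :
  measurable_fun setT f -> (forall x, 0 <= f x)%E ->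
  (\int[lebesgue_tuple R n.+1]_x f x =
   \int[@lebesgue_measure R]_x \int[lebesgue_tuple R n]_y f (cons_pair (x, y)))%E.
Proof.
move=> mf f0.
pose mc : {mfun (measurableTypeR R * n.-tuple R)%type >-> n.+1.-tuple R} :=
  HB.pack (@cons_pair R n) (isMeasurableFun.Build _ _ _ _ _ (@measurable_cons_pair R n)).
transitivity (\int[pushforward (@lebesgue_measure R \x lebesgue_tuple R n) mc]_x f x)%E.
  by apply: eq_measure_integral.
rewrite ge0_integral_pushforward//.
rewrite fubini_tonelli1//.
  exact: measurableT_comp.
by move=> x; exact: f0.
Qed.

Definition insert_tuple (T : Type) n (l : 'I_n.+1) (x : T) (y : n.-tuple T) :
    n.+1.-tuple T :=
  [tuple if unlift l i is Some j then tnth y j else x | i < n.+1].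

Lemma tnth_insert T n (l : 'I_n.+1) (x : T) (y : n.-tuple T) :
  tnth (insert_tuple l x y) l = x.
Proof. by rewrite tnth_mktuple unlift_none. Qed.

Lemma tnth_insert_lift T n (l : 'I_n.+1) (x : T) (y : n.-tuple T) j :
  tnth (insert_tuple l x y) (lift l j) = tnth y j.
Proof. by rewrite tnth_mktuple liftK. Qed.

(** Inserting at position [l] is inserting at the head and then permuting; this
    reduces Tonelli's theorem at any coordinate to the first one. *)
Lemma insert_tuple_perm (R : realType) n (l : 'I_n.+1) (x : R) (y : n.-tuple R) :
  insert_tuple l x y =
  perm_tuple (lift_perm l ord0 1%g) (cons_pair (x : measurableTypeR R, y)).
Proof.
apply: eq_from_tnth => i; rewrite [RHS]tnth_mktuple.
case: (unliftP l i) => [j ->|->].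
  by rewrite tnth_insert_lift lift_perm_lift perm1 tnthS; congr tnth; exact: val_inj.
by rewrite tnth_insert lift_perm_id.
Qed.

Lemma measurable_insert (R : realType) n (l : 'I_n.+1) (x : R) :
  measurable_fun setT (fun y : n.-tuple R => insert_tuple l x y).
Proof.
apply/measurable_fun_tnthP => i.
case: (unliftP l i) => [j ->|->].
  rewrite (_ : _ \o _ = fun y => tnth y j); first exact: measurable_tnth.
  by apply/funext => y /=; rewrite tnth_insert_lift.
rewrite (_ : _ \o _ = cst x); first exact: measurable_cst.
by apply/funext => y /=; rewrite tnth_insert.
Qed.

Lemma ge0_integral_insert (R : realType) n (l : 'I_n.+1) (f : n.+1.-tuple R -> \bar R) :
  measurable_fun setT f -> (forall x, 0 <= f x)%E ->
  (\int[lebesgue_tuple R n.+1]_x f x =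
   \int[@lebesgue_measure R]_x \int[lebesgue_tuple R n]_y f (insert_tuple l x y))%E.
Proof.
move=> mf f0.
rewrite -(ge0_integral_perm_tuple (lift_perm l ord0 1%g) mf f0).
have mfp : measurable_fun setT
    (fun x => f (perm_tuple (lift_perm l ord0 1%g) x)).
  exact: (measurableT_comp mf (measurable_perm_tuple _)).
rewrite (ge0_integral_cons mfp (fun x => f0 _)).
apply: eq_integral => x _; apply: eq_integral => y _.
by rewrite insert_tuple_perm.
Qed.

Lemma measurable_integral_insert (R : realType) n (l : 'I_n.+1)
    (f : n.+1.-tuple R -> \bar R) :
  measurable_fun setT f -> (forall x, 0 <= f x)%E ->
  measurable_fun [set: measurableTypeR R]
    (fun x => \int[lebesgue_tuple R n]_y f (insert_tuple l x y))%E.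
Proof.
move=> mf f0.
under eq_fun do under eq_integral do rewrite insert_tuple_perm.
apply: (@measurable_fun_fubini_tonelli_F _ _ _ _ _ (lebesgue_tuple R n)
  (fun p => f (perm_tuple (lift_perm l ord0 1%g) (cons_pair p)))) => //.
apply: (measurableT_comp mf).
exact: (measurableT_comp (measurable_perm_tuple _) (@measurable_cons_pair R n)).
Qed.

(** * Integrals of complex functions and products of two independent variables *)

Lemma complexReM (R : realType) (a b : R[i]) :
  complex.Re (a * b) = complex.Re a * complex.Re b - complex.Im a * complex.Im b.
Proof. by case: a; case: b. Qed.

Lemma complexImM (R : realType) (a b : R[i]) :
  complex.Im (a * b) = complex.Re a * complex.Im b + complex.Im a * complex.Re b.
Proof. by case: a => a1 a2; case: b => b1 b2 /=. Qed.

Section complex_integral.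
Context d (T : measurableType d) (R : realType).
Variables (mu : {measure set T -> \bar R}) (D : set T).
Hypothesis mD : measurable D.

Lemma eq_cintegral (f g : T -> R[i]) : (forall x, D x -> f x = g x) ->
  cintegral mu D f = cintegral mu D g.
Proof.
by move=> fg; congr (_ +i* _); apply: eq_Rintegral => x /set_mem Dx; rewrite fg.
Qed.

Lemma eq_cintegrable (f g : T -> R[i]) : (forall x, D x -> f x = g x) ->
  cintegrable mu D f -> cintegrable mu D g.
Proof.
move=> fg [f1 f2]; split.
  by apply: eq_integrable f1 => // x /set_mem Dx /=; rewrite fg.
by apply: eq_integrable f2 => // x /set_mem Dx /=; rewrite fg.
Qed.

Lemma cintegrable0 : cintegrable mu D (fun=> 0).
Proof. by split; exact: integrable0. Qed.

Lemma cintegral0 : cintegral mu D (fun=> 0) = 0.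
Proof. by rewrite /cintegral /= !Rintegral_cst// !mul0r. Qed.

Lemma cintegrableD (f g : T -> R[i]) :
  cintegrable mu D f -> cintegrable mu D g -> cintegrable mu D (fun x => f x + g x).
Proof.
move=> [f1 f2] [g1 g2]; split.
  apply: eq_integrable (integrableD mD f1 g1) => // x _.
  by rewrite /= raddfD.
apply: eq_integrable (integrableD mD f2 g2) => // x _.
by rewrite /= raddfD.
Qed.

Lemma cintegralD (f g : T -> R[i]) :
  cintegrable mu D f -> cintegrable mu D g ->
  cintegral mu D (fun x => f x + g x) = cintegral mu D f + cintegral mu D g.
Proof.
move=> [f1 f2] [g1 g2]; rewrite /cintegral.
under eq_Rintegral do rewrite raddfD.
under [X in _ +i* X]eq_Rintegral do rewrite raddfD.
by rewrite !RintegralD.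
Qed.

Lemma cintegrableZl (c : R[i]) (f : T -> R[i]) :
  cintegrable mu D f -> cintegrable mu D (fun x => c * f x).
Proof.
move=> [f1 f2]; split.
  apply: eq_integrable (integrableB mD (integrableZl mD (complex.Re c) f1)
    (integrableZl mD (complex.Im c) f2)) => // x _.
  by rewrite /= complexReM.
apply: eq_integrable (integrableD mD (integrableZl mD (complex.Re c) f2)
    (integrableZl mD (complex.Im c) f1)) => // x _.
by rewrite /= complexImM.
Qed.

Lemma cintegralZl (c : R[i]) (f : T -> R[i]) :
  cintegrable mu D f -> cintegral mu D (fun x => c * f x) = c * cintegral mu D f.
Proof.
move=> [f1 f2]; rewrite /cintegral.
under eq_Rintegral do rewrite complexReM.
under [X in _ +i* X]eq_Rintegral do rewrite complexImM.
have Zl (r : R) (g : T -> R) : mu.-integrable D (EFin \o g) ->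
    mu.-integrable D (EFin \o (fun x => r * g x)).
  by move=> gi; apply: eq_integrable (integrableZl mD r gi) => // x _.
rewrite RintegralB ?RintegralD//; try exact: Zl.
by rewrite !RintegralZl//; case: c.
Qed.

Lemma cintegrable_sum (I : Type) (r : seq I) (P : pred I) (F : I -> T -> R[i]) :
  (forall i, P i -> cintegrable mu D (F i)) ->
  cintegrable mu D (fun x => \sum_(i <- r | P i) F i x).
Proof.
move=> Fi; elim: r => [|i r IH].
  by apply: eq_cintegrable cintegrable0 => x _; rewrite big_nil.
rewrite (_ : (fun x => _) = fun x =>
    if P i then F i x + \sum_(j <- r | P j) F j x else \sum_(j <- r | P j) F j x).
  by case Pi: (P i) => //; apply: cintegrableD => //; exact: Fi.
by apply/funext => x; rewrite big_cons.
Qed.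

Lemma cintegral_sum (I : Type) (r : seq I) (P : pred I) (F : I -> T -> R[i]) :
  (forall i, P i -> cintegrable mu D (F i)) ->
  cintegral mu D (fun x => \sum_(i <- r | P i) F i x) =
  \sum_(i <- r | P i) cintegral mu D (F i).
Proof.
move=> Fi; elim: r => [|i r IH].
  rewrite big_nil; apply: etrans cintegral0.
  by apply: eq_cintegral => x _; rewrite big_nil.
rewrite big_cons (_ : (fun x => _) = fun x =>
    if P i then F i x + \sum_(j <- r | P j) F j x else \sum_(j <- r | P j) F j x).
  case Pi: (P i) => //; rewrite cintegralD ?IH//; first exact: Fi.
  exact: cintegrable_sum.
by apply/funext => x; rewrite big_cons.
Qed.

End complex_integral.

Section product_integral.
Context d1 d2 (T1 : measurableType d1) (T2 : measurableType d2) (R : realType).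
Variables (m1 : {sigma_finite_measure set T1 -> \bar R}).
Variables (m2 : {sigma_finite_measure set T2 -> \bar R}).

(** Stated for everywhere defined functions, since Fubini's theorem is; the
    versions on rectangles follow by extending by zero. *)
Lemma integrable_prodM_setT (a : T1 -> R) (b : T2 -> R) :
  m1.-integrable setT (EFin \o a) -> m2.-integrable setT (EFin \o b) ->
  (m1 \x m2)%E.-integrable setT (EFin \o (fun z => a z.1 * b z.2)).
Proof.
move=> ia ib.
have ma : measurable_fun setT a by apply/measurable_EFinP; exact: measurable_int ia.
have mb : measurable_fun setT b by apply/measurable_EFinP; exact: measurable_int ib.
apply/integrable12ltyP => /=.
  apply/measurable_EFinP; apply: measurable_funM.
    exact: measurableT_comp.
  exact: measurableT_comp.
have -> : (fun x => \int[m2]_y `|(a x * b y)%:E|)%E =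
   (fun x => `|(a x)%:E| * \int[m2]_y `|(b y)%:E|)%E.
  apply/funext => x.
  under eq_integral do rewrite EFinM abseM.
  by rewrite ge0_integralZl//; exact/measurableT_comp/measurable_int/ib.
move/integrableP : ib => [_ ib]; move/integrableP : ia => [mEa ia].
rewrite -(@fineK _ (\int[m2]_y `|(b y)%:E|)%E); last first.
  by rewrite ge0_fin_numE// integral_ge0.
rewrite ge0_integralZr//; last 2 first.
  exact: measurableT_comp.
  by rewrite lee_fin fine_ge0// integral_ge0.
by rewrite lte_mul_pinfty// ?integral_ge0// ?ltry// ge0_fin_numE ?integral_ge0.
Qed.

Lemma Rintegral_prodM_setT (a : T1 -> R) (b : T2 -> R) :
  m1.-integrable setT (EFin \o a) -> m2.-integrable setT (EFin \o b) ->
  \int[(m1 \x m2)%E]_z (a z.1 * b z.2) = (\int[m1]_x a x) * (\int[m2]_y b y).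
Proof.
move=> ia ib; rewrite {1}/Rintegral.
rewrite -(integral12_prod_meas1 (integrable_prodM_setT ia ib)).
rewrite /fubini_F -(RintegralZr _ _ ia)//; congr fine.
apply: eq_integral => x _.
under eq_integral do rewrite /= EFinM.
rewrite integralZl//= EFinM; congr (_ * _)%E.
by rewrite fineK//; exact: integrable_fin_num.
Qed.

Lemma prodM_restrict (A : set T1) (B : set T2) (a : T1 -> R) (b : T2 -> R) :
  (fun z => a z.1 * b z.2) \_ (A `*` B) =
  (fun z => (a \_ A) z.1 * (b \_ B) z.2).
Proof.
apply/funext => -[x y] /=; rewrite !patchE /=.
rewrite in_setX /=; case: (x \in A); case: (y \in B); rewrite /= ?mul0r ?mulr0//.
Qed.

Lemma integrable_prodM (A : set T1) (B : set T2) (a : T1 -> R) (b : T2 -> R) :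
  measurable A -> measurable B ->
  m1.-integrable A (EFin \o a) -> m2.-integrable B (EFin \o b) ->
  (m1 \x m2)%E.-integrable (A `*` B) (EFin \o (fun z => a z.1 * b z.2)).
Proof.
move=> mA mB /integrable_mkcond; rewrite restrict_EFin => /(_ mA) ia.
move/integrable_mkcond; rewrite restrict_EFin => /(_ mB) ib.
apply/integrable_mkcond; first exact: measurableX.
by rewrite restrict_EFin prodM_restrict; exact: integrable_prodM_setT.
Qed.

Lemma Rintegral_prodM (A : set T1) (B : set T2) (a : T1 -> R) (b : T2 -> R) :
  measurable A -> measurable B ->
  m1.-integrable A (EFin \o a) -> m2.-integrable B (EFin \o b) ->
  \int[(m1 \x m2)%E]_(z in A `*` B) (a z.1 * b z.2) =
  (\int[m1]_(x in A) a x) * (\int[m2]_(y in B) b y).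
Proof.
move=> mA mB /integrable_mkcond; rewrite restrict_EFin => /(_ mA) ia.
move/integrable_mkcond; rewrite restrict_EFin => /(_ mB) ib.
by rewrite Rintegral_mkcond prodM_restrict Rintegral_prodM_setT// -!Rintegral_mkcond.
Qed.

Lemma cintegrable_prodM (A : set T1) (B : set T2) (f : T1 -> R[i]) (g : T2 -> R[i]) :
  measurable A -> measurable B -> cintegrable m1 A f -> cintegrable m2 B g ->
  cintegrable (m1 \x m2)%E (A `*` B) (fun z => f z.1 * g z.2).
Proof.
move=> mA mB [f1 f2] [g1 g2]; have mAB := measurableX mA mB; split.
  apply: eq_integrable (integrableB mAB (integrable_prodM mA mB f1 g1)
    (integrable_prodM mA mB f2 g2)) => // x _.
  by rewrite /= complexReM.
apply: eq_integrable (integrableD mAB (integrable_prodM mA mB f1 g2)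
    (integrable_prodM mA mB f2 g1)) => // x _.
by rewrite /= complexImM.
Qed.

Lemma cintegral_prodM (A : set T1) (B : set T2) (f : T1 -> R[i]) (g : T2 -> R[i]) :
  measurable A -> measurable B -> cintegrable m1 A f -> cintegrable m2 B g ->
  cintegral (m1 \x m2)%E (A `*` B) (fun z => f z.1 * g z.2) =
  cintegral m1 A f * cintegral m2 B g.
Proof.
move=> mA mB [f1 f2] [g1 g2]; have mAB := measurableX mA mB.
rewrite /cintegral.
under eq_Rintegral do rewrite complexReM.
under [X in _ +i* X]eq_Rintegral do rewrite complexImM.
rewrite RintegralB//; [|exact: (integrable_prodM mA mB f1 g1)
  |exact: (integrable_prodM mA mB f2 g2)].
rewrite RintegralD//; [|exact: (integrable_prodM mA mB f1 g2)
  |exact: (integrable_prodM mA mB f2 g1)].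
move: (Rintegral_prodM mA mB f1 g1) (Rintegral_prodM mA mB f2 g2)
  (Rintegral_prodM mA mB f1 g2) (Rintegral_prodM mA mB f2 g1).
by move=> /= -> -> -> ->.
Qed.

End product_integral.

(** * Integrals of products of one-variable functions over a box *)

Definition uncons_pair (R : realType) n (t : n.+1.-tuple R) :
    measurableTypeR R * n.-tuple R :=
  (tnth t ord0, [tuple of behead t]).

Lemma cons_pairK (R : realType) n : cancel (@uncons_pair R n) (@cons_pair R n).
Proof. by move=> t; rewrite /cons_pair /= [RHS]tuple_eta; exact/val_inj. Qed.

Lemma measurable_uncons_pair (R : realType) n :
  measurable_fun setT (@uncons_pair R n).
Proof.
apply: measurable_fun_pair; [exact: measurable_tnth|exact: measurable_behead].
Qed.

Section lebesgue_tuple_cons.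
Variables (R : realType) (n : nat).
Let mc : {mfun (measurableTypeR R * n.-tuple R)%type >-> n.+1.-tuple R} :=
  HB.pack (@cons_pair R n)
    (isMeasurableFun.Build _ _ _ _ _ (@measurable_cons_pair R n)).

(** Since [cons_pair] has a measurable inverse, [f] inherits measurability from
    its composition with [cons_pair]. *)
Lemma integrable_cons_setT (f : n.+1.-tuple R -> R) :
  (lebesgue_measure \x lebesgue_tuple R n)%E.-integrable setT
    (EFin \o (f \o @cons_pair R n)) ->
  (lebesgue_tuple R n.+1).-integrable setT (EFin \o f) /\
  \int[lebesgue_tuple R n.+1]_x f x =
  \int[(lebesgue_measure \x lebesgue_tuple R n)%E]_z f (cons_pair z).
Proof.
move=> fi.
have mf : measurable_fun setT (EFin \o f).
  rewrite (_ : EFin \o f =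
    (EFin \o (f \o @cons_pair R n)) \o @uncons_pair R n).
    apply: measurableT_comp (@measurable_uncons_pair R n).
    exact: measurable_int fi.
  by apply/funext => x /=; rewrite cons_pairK.
have push (g : n.+1.-tuple R -> \bar R) :
   (\int[lebesgue_tuple R n.+1]_x g x =
    \int[pushforward (lebesgue_measure \x lebesgue_tuple R n)%E mc]_x g x)%E.
  by apply: eq_measure_integral.
split; last first.
  by rewrite /Rintegral push integral_pushforward.
apply/integrableP; split => //; rewrite push.
have /integrableP[_] := @integrable_pushforward _ _ _ _ _ mc
  (@measurable_cons_pair R n) (lebesgue_measure \x lebesgue_tuple R n)%E setT _
  mf fi measurableT.
by [].
Qed.

Lemma integrable_cons (D : set (n.+1.-tuple R)) (f : n.+1.-tuple R -> R) :
  measurable D ->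
  (lebesgue_measure \x lebesgue_tuple R n)%E.-integrable (@cons_pair R n @^-1` D)
    (EFin \o (f \o @cons_pair R n)) ->
  (lebesgue_tuple R n.+1).-integrable D (EFin \o f) /\
  \int[lebesgue_tuple R n.+1]_(x in D) f x =
  \int[(lebesgue_measure \x lebesgue_tuple R n)%E]_(z in @cons_pair R n @^-1` D)
    f (cons_pair z).
Proof.
move=> mD fi.
have mD' : measurable (@cons_pair R n @^-1` D).
  by rewrite -[X in measurable X]setTI; exact: measurable_cons_pair.
have E : (f \_ D) \o @cons_pair R n = (f \o @cons_pair R n) \_ (@cons_pair R n @^-1` D).
  by apply/funext => z /=; rewrite !patchE.
have [] := @integrable_cons_setT (f \_ D).
  by rewrite E -restrict_EFin; exact: (integrable_mkcond _ mD').1.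
rewrite -restrict_EFin => fD fE.
split; first exact: (integrable_mkcond _ mD).2.
rewrite Rintegral_mkcond fE [RHS]Rintegral_mkcond; apply: eq_Rintegral => z _.
by rewrite !patchE.
Qed.

Lemma cintegrable_cons (D : set (n.+1.-tuple R)) (f : n.+1.-tuple R -> R[i]) :
  measurable D ->
  cintegrable (lebesgue_measure \x lebesgue_tuple R n)%E (@cons_pair R n @^-1` D)
    (fun z => f (cons_pair z)) ->
  cintegrable (lebesgue_tuple R n.+1) D f /\
  cintegral (lebesgue_tuple R n.+1) D f =
  cintegral (lebesgue_measure \x lebesgue_tuple R n)%E (@cons_pair R n @^-1` D)
    (fun z => f (cons_pair z)).
Proof.
move=> mD [f1 f2].
have [i1 e1] := @integrable_cons D (fun x => complex.Re (f x)) mD f1.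
have [i2 e2] := @integrable_cons D (fun x => complex.Im (f x)) mD f2.
split; first by split.
by rewrite /cintegral e1 e2.
Qed.

End lebesgue_tuple_cons.

Lemma cintegral_box_prod (R : realType) n (J : 'I_n -> set R) (u : 'I_n -> R -> R[i]) :
  (forall i, measurable (J i)) ->
  (forall i, cintegrable lebesgue_measure (J i) (u i)) ->
  cintegrable (lebesgue_tuple R n) (box J) (fun y => \prod_(i < n) u i (tnth y i)) /\
  cintegral (lebesgue_tuple R n) (box J) (fun y => \prod_(i < n) u i (tnth y i)) =
  \prod_(i < n) cintegral lebesgue_measure (J i) (u i).
Proof.
elim: n J u => [|n IH] J u mJ iu.
  have -> : box J = setT by rewrite -subTset => x _ [].
  have E : (fun y : 0.-tuple R => \prod_(i < 0) u i (tnth y i)) = fun=> 1.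
    by apply/funext => y; rewrite big_ord0.
  have mu1 : lebesgue_tuple R 0 setT = 1%E by rewrite /= diracT.
  rewrite E big_ord0; split.
    have ic (r : R) :
        (lebesgue_tuple R 0).-integrable setT (EFin \o (fun=> r)).
      apply/integrableP; split; first exact: measurable_cst.
      rewrite (eq_integral (cst `|r|%:E)%E)// integral_cst//.
      by rewrite [X in (_ * X)%E](_ : _ = 1%E) ?mule1 ?ltry// mu1.
    by split; exact: ic.
  rewrite /cintegral !Rintegral_cst//=.
  by rewrite indicT mulr1 mul0r.
have [IHi IHe] := IH (fun i => J (lift ord0 i)) (fun i => u (lift ord0 i))
  (fun i => mJ _) (fun i => iu _).
have mB : measurable (box (fun i => J (lift ord0 i))) by exact: measurable_box.
have E0 : @cons_pair R n @^-1` box J = J ord0 `*` box (fun i => J (lift ord0 i)).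
  apply/seteqP; split => [[x t] /= h|[x t] /= [hx ht] i].
    by split=> [|i]; [exact: (h ord0)|have := h (lift ord0 i); rewrite tnthS].
  by case: (unliftP ord0 i) => [j ->|->//]; rewrite tnthS; exact: ht.
have mJ0 : measurable (J ord0 : set (measurableTypeR R)) by exact: mJ.
have E1 (z : (measurableTypeR R * n.-tuple R)%type) : \prod_(i < n.+1) u i (tnth (cons_pair z) i) =
    u ord0 z.1 * \prod_(i < n) u (lift ord0 i) (tnth z.2 i).
  rewrite big_ord_recl; congr (_ * _); apply: eq_bigr => i _.
  by rewrite tnthS; congr (u _ (tnth _ _)); exact: val_inj.
have [] := @cintegrable_cons R n (box J) (fun y => \prod_(i < n.+1) u i (tnth y i)).
- exact: measurable_box.
- rewrite E0.
  apply: (eq_cintegrable (measurableX mJ0 mB) (fun z _ => esym (E1 z))).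
  exact: (cintegrable_prodM mJ0 mB (iu ord0) IHi).
- move=> i1 e1; split => //; rewrite {}e1 big_ord_recl -IHe E0.
  rewrite (eq_cintegral _ (fun z _ => E1 z)).
  exact: (cintegral_prodM mJ0 mB (iu ord0) IHi).
Qed.

(** * The two determinants, and permutations preserving a set *)

Lemma perm_tupleM (T : Type) n (p r : 'S_n) (x : n.-tuple T) :
  perm_tuple (p * r)%g x = perm_tuple p (perm_tuple r x).
Proof. by apply: eq_from_tnth => i; rewrite !tnth_mktuple permM. Qed.

Lemma perm_tuple1 (T : Type) n (x : n.-tuple T) : perm_tuple 1%g x = x.
Proof. by apply: eq_from_tnth => i; rewrite tnth_mktuple perm1. Qed.

Lemma insert_perm_tuple (T : Type) n (l : 'I_n.+1) (x : T) (p : 'S_n) (y : n.-tuple T) :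
  insert_tuple l x (perm_tuple p y) = perm_tuple (lift_perm l l p) (insert_tuple l x y).
Proof.
apply: eq_from_tnth => i; rewrite [RHS]tnth_mktuple.
case: (unliftP l i) => [j ->|->].
  by rewrite lift_perm_lift !tnth_insert_lift tnth_mktuple.
by rewrite lift_perm_id !tnth_insert.
Qed.

Lemma Psi_mx_lshift (R : realType) M q (Psi : 'I_(M + q) -> R -> R[i])
    (Psibar : 'I_(M + q) -> 'I_(M + q) -> R[i]) x i (k : 'I_M) :
  Psi_mx Psi Psibar x i (lshift q k) = Psi i (tnth x k).
Proof. by rewrite mxE /= valK. Qed.

Lemma Psi_mx_rshift (R : realType) M q (Psi : 'I_(M + q) -> R -> R[i])
    (Psibar : 'I_(M + q) -> 'I_(M + q) -> R[i]) (x : M.-tuple R) i (k : 'I_q) :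
  Psi_mx Psi Psibar x i (rshift M k) = Psibar i (rshift M k).
Proof. by rewrite mxE /= insubF// ltnNge leq_addr. Qed.

Lemma det_Psi_mx_tperm (R : realType) M q (Psi : 'I_(M + q) -> R -> R[i])
    (Psibar : 'I_(M + q) -> 'I_(M + q) -> R[i]) (x : M.-tuple R) (i j : 'I_M) :
  i != j ->
  \det (Psi_mx Psi Psibar (perm_tuple (tperm i j) x)) = - \det (Psi_mx Psi Psibar x).
Proof.
move=> ij.
have -> : Psi_mx Psi Psibar (perm_tuple (tperm i j) x) =
    xcol (lshift q i) (lshift q j) (Psi_mx Psi Psibar x).
  apply/matrixP => a b; rewrite [RHS]mxE.
  case: (split_ordP b) => [k ->|k ->].
    rewrite Psi_mx_lshift tnth_mktuple -(Psi_mx_lshift Psi Psibar x a).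
    congr (Psi_mx _ _ _ _ _); apply/val_inj.
    have [->|/negPf nik] := eqVneq i k; first by rewrite !tpermL.
    have [->|/negPf njk] := eqVneq j k; first by rewrite !tpermR.
    by rewrite !tpermD// ?eq_lshift ?nik ?njk.
  by rewrite tpermD ?eq_lrshift// !Psi_mx_rshift.
by rewrite xcolE det_mulmx det_perm odd_tperm eq_lshift ij /= expr1 mulrN1.
Qed.

Lemma det_Psi_mx_tie (R : realType) M q (Psi : 'I_(M + q) -> R -> R[i])
    (Psibar : 'I_(M + q) -> 'I_(M + q) -> R[i]) (x : M.-tuple R) (i j : 'I_M) :
  i != j -> tnth x i = tnth x j -> \det (Psi_mx Psi Psibar x) = 0.
Proof.
move=> ij xij; rewrite -det_tr.
apply: (@determinant_alternate _ _ _ (lshift q i) (lshift q j)).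
  by rewrite eq_lshift.
by move=> a; rewrite !mxE -/(Psi_mx Psi Psibar x) /= !valK xij.
Qed.

(** Each transposition flips the sign of both determinants; decomposing [p] into
    transpositions avoids extending [p] to a permutation of all the columns. *)
Lemma det_Psi_mx2_perm (R : realType) M q (Psi Psi' : 'I_(M + q) -> R -> R[i])
    (Psibar Psibar' : 'I_(M + q) -> 'I_(M + q) -> R[i]) (p : 'S_M) (x : M.-tuple R) :
  \det (Psi_mx Psi Psibar (perm_tuple p x)) *
  \det (Psi_mx Psi' Psibar' (perm_tuple p x)) =
  \det (Psi_mx Psi Psibar x) * \det (Psi_mx Psi' Psibar' x).
Proof.
have [ts -> /=] := prod_tpermP p.
elim: ts => [|[i j] ts IH]; first by rewrite big_nil perm_tuple1.
case/andP => /= ij /IH {}IH.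
by rewrite big_cons perm_tupleM /= !det_Psi_mx_tperm// mulrNN.
Qed.

(** The pseudo-determinant of a tensor whose slices along the last index have
    rank one splits into two ordinary determinants. *)
Lemma pseudo_det_mul (C : comNzRingType) n (A B : 'M[C]_n) :
  pseudo_det (fun i j k => A i k * B j k) = \det A * \det B.
Proof.
rewrite /pseudo_det -(det_tr A) -(det_tr B) /determinant mulr_suml.
apply: eq_bigr => mu _; rewrite -mulrA; congr (_ * _).
rewrite mulr_sumr; apply: eq_bigr => al _.
rewrite [RHS]mulrCA; congr (_ * _); rewrite -big_split /=.
by apply: eq_bigr => k _; rewrite !mxE.
Qed.

(** The matrix is block lower triangular: right of the first [M] columns it is
    zero above row [M] and lower unitriangular below. *)
Lemma det_varsigma_mx (R : realType) M q (Phi : 'I_M -> R -> R[i]) (xi : R -> R[i])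
    (x : M.-tuple R) :
  \det (Psi_mx (varsigma (N := M + q) Phi xi) (fun i k => (k <= i)%:R) x) =
  \det (Phi_mx Phi x) * \prod_(i < M) xi (tnth x i).
Proof.
set B := Psi_mx _ _ _.
have -> : B = block_mx (Phi_mx Phi x *m diag_mx (\row_i xi (tnth x i))) 0
    (dlsubmx B) (drsubmx B).
  rewrite -[LHS]submxK; congr block_mx; apply/matrixP => i k.
    rewrite !mxE /= valK /varsigma /= valK.
    under eq_bigr do rewrite !mxE.
    rewrite (bigD1 k)//= big1 ?addr0 ?eqxx ?mulr1n ?mulr_natr//.
    by move=> j /negPf jk; rewrite jk mulr0n mulr0.
  rewrite mxE [LHS]mxE Psi_mx_rshift/= leqNgt.
  by rewrite (leq_trans (ltn_ord i) (leq_addr _ _)) mxE.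
rewrite det_lblock det_mulmx det_diag [X in _ * X]det_trig; last first.
  apply/is_trig_mxP => i j ij.
  by rewrite !mxE /= insubF ?[(_ < M)%N]ltnNge ?leq_addr//= leq_add2l leqNgt ij.
rewrite [X in _ * X]big1 ?mulr1; last first.
  by move=> i _; rewrite !mxE /= insubF ?[(_ < M)%N]ltnNge ?leq_addr//= leqnn.
by congr (_ * _); apply: eq_bigr => i _; rewrite mxE.
Qed.

(** A permutation preserving [S] is uniquely a permutation of [S] followed by one
    of its complement. *)
Lemma card_astabs_perm (T : finType) (S : {set T}) :
  #|('N(S | 'P))%g| = ((#|S|)`! * (#|~: S|)`!)%N.
Proof.
have astabsE (U : {set T}) (s : {perm T}) :
    (s \in 'N(U | 'P))%g = [forall x, (s x \in U) == (x \in U)].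
  apply/idP/forallP => [sU x|sU]; last by apply/astabsP => x; exact/eqP/sU.
  by have := astabs_act x sU; rewrite /= apermE => ->.
have perm_on_astabs (U : {set T}) (s : {perm T}) :
    perm_on U s -> (s \in 'N(U | 'P))%g.
  by move=> sV; rewrite astabsE; apply/forallP => x; rewrite perm_closed.
have -> : ('N(S | 'P))%g = (Sym S * Sym (~: S))%g.
  apply/setP => s; apply/idP/mulsgP => [sN|[s1 s2 s1S s2S ->]]; last first.
    apply: groupM; first by apply: perm_on_astabs; rewrite inE in s1S.
    have : s2 \in ('N(~: S | 'P))%g by apply: perm_on_astabs; rewrite inE in s2S.
    by rewrite astabsC.
  exists (restr_perm S s) (restr_perm (~: S) s); rewrite ?inE ?restr_perm_on//.
  have sNC : (s \in 'N(~: S | 'P))%g by rewrite astabsC.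
  apply/permP => x; rewrite permM.
  have [xS|xS] := boolP (x \in S).
    rewrite (restr_permE sN xS) (out_perm (restr_perm_on _ _))//.
    by rewrite inE negbK; have := astabs_act x sN; rewrite /= apermE => ->.
  by rewrite (out_perm (restr_perm_on _ _) xS) restr_permE// inE.
rewrite TI_cardMg ?card_Sym//.
apply/trivgP/fintype.subsetP => s; rewrite !inE => /andP[s1 s2]; apply/eqP/permP => x.
rewrite perm1; have [xS|xS] := boolP (x \in S); last by rewrite (out_perm s1).
by rewrite (out_perm s2)// inE xS.
Qed.

(** * Sorting permutations *)

Definition below_ord n l : {set 'I_n} := [set j : 'I_n | (j < l)%N]%SET.

Lemma card_below_ord n l : (l <= n)%N -> #|below_ord n l| = l.
Proof.
move=> ln; have -> : below_ord n l = [set widen_ord ln i | i : 'I_l]%SET.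
  apply/setP => j; rewrite inE; apply/idP/imsetP => [jl|[i _ ->]].
    by exists (Ordinal jl) => //; exact: val_inj.
  by rewrite /= ltn_ord.
rewrite card_imset ?card_ord// => i j /(congr1 val) /=; exact: val_inj.
Qed.

Definition decreasing_tuple (R : realType) n (x : n.-tuple R) :=
  [forall i : 'I_n, forall j : 'I_n, (i <= j)%N ==> (tnth x j <= tnth x i)].

Lemma decreasing_tupleP (R : realType) n (x : n.-tuple R) :
  reflect (forall i j : 'I_n, (i <= j)%N -> tnth x j <= tnth x i)
    (decreasing_tuple x).
Proof.
by apply: (iffP forallP) => [h i j|h i];
  [move/forallP: (h i) => /(_ j)/implyP|apply/forallP => j; apply/implyP; exact: h].
Qed.

Lemma decreasing_tuple_sorted (R : realType) n (x : n.-tuple R) :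
  decreasing_tuple x = sorted >=%R x.
Proof.
apply/decreasing_tupleP/idP => [h|h i j ij].
  apply/(sortedP 0) => i; rewrite size_tuple => il.
  have il' := ltnW il.
  by have := h (Ordinal il') (Ordinal il) (leqnSn i); rewrite !(tnth_nth 0).
rewrite !(tnth_nth 0).
apply: (sorted_leq_nth (leT := >=%R) _ _ _ h) => //.
- by move=> a b c /= ab bc; exact: le_trans ab.
- by move=> a /=.
- by rewrite inE size_tuple.
- by rewrite inE size_tuple.
Qed.

Section count_sorting.
Variables (R : realType) (n : nat) (l : 'I_n.+1) (x : R) (y : n.-tuple R).
Hypothesis inj_xy : injective (tnth (insert_tuple l x y)).

Let inj_y : injective (tnth y).
Proof.
move=> i j yij; apply: (@lift_inj _ l); apply: inj_xy.
by rewrite !tnth_insert_lift.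
Qed.

Let neq_xy j : tnth y j != x.
Proof.
apply/eqP => yx; have /eqP := neq_lift l j; apply; apply: inj_xy.
by rewrite tnth_insert tnth_insert_lift.
Qed.

Let lift_leq (j : 'I_n) : (lift l j <= l)%N = (j < l)%N.
Proof.
rewrite /= /bump; case: (leqP l j) => jl; last exact: ltnW.
by rewrite add1n ltnNge jl. Qed.

(** Since [x] sits at position [l], the order constraint separates into an order
    on [y] alone and the position of each entry relative to [x]. *)
Lemma decreasing_insert_perm (p : 'S_n) :
  decreasing_tuple (insert_tuple l x (perm_tuple p y)) =
  decreasing_tuple (perm_tuple p y) &&
  [forall j : 'I_n, if (j < l)%N then x <= tnth y (p j) else tnth y (p j) <= x].
Proof.
apply/decreasing_tupleP/andP => [h|[/decreasing_tupleP h1 /forallP h2] i j].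
  split; first by apply/decreasing_tupleP => i j ij;
    rewrite -!(tnth_insert_lift l x); apply: h; rewrite leq_bump2.
  apply/forallP => j; case: ifPn => jl.
    rewrite -[X in X <= _](tnth_insert l x (perm_tuple p y)).
    rewrite -(tnth_mktuple (fun i => tnth y (p i))).
    by rewrite -(tnth_insert_lift l x); apply: h; rewrite lift_leq.
  rewrite -[X in _ <= X](tnth_insert l x (perm_tuple p y)).
  rewrite -(tnth_mktuple (fun i => tnth y (p i))).
  rewrite -(tnth_insert_lift l x); apply: h.
  by rewrite ltnW// ltnNge lift_leq.
case: (unliftP l i) => [i' ->|->]; case: (unliftP l j) => [j' ->|->].
- by rewrite leq_bump2 !tnth_insert_lift; exact: h1.
- rewrite lift_leq tnth_insert tnth_insert_lift tnth_mktuple => il.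
  by have := h2 i'; rewrite il.
- rewrite tnth_insert tnth_insert_lift tnth_mktuple => lj.
  have := h2 j'; rewrite ifN// -lift_leq -ltnNge ltn_neqAle lj andbT.
  exact: neq_lift.
- by [].
Qed.

Lemma decreasing_perm_uniq (p1 p2 : 'S_n) :
  decreasing_tuple (perm_tuple p1 y) -> decreasing_tuple (perm_tuple p2 y) ->
  p1 = p2.
Proof.
rewrite !decreasing_tuple_sorted => s1 s2.
have E : perm_tuple p1 y = perm_tuple p2 y.
  apply/val_inj; apply: (sorted_eq (leT := >=%R)) s1 s2 _.
  - by move=> a b c /= ab bc; exact: le_trans ab.
  - by move=> a b /= /le_anti.
  - apply: (@perm_trans _ y); last rewrite perm_sym; apply/tuple_permP.
      by exists p1.
    by exists p2.
apply/permP => j; apply: inj_y.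
by have := congr1 (fun t => tnth t j) E; rewrite !tnth_mktuple.
Qed.

Lemma decreasing_perm_exists :
  exists p : 'S_n, decreasing_tuple (perm_tuple p y).
Proof.
have : perm_eq (sort >=%R y) y by rewrite perm_sort.
move=> /tuple_permP[p yp]; exists p; rewrite decreasing_tuple_sorted.
rewrite -[tval _]yp; apply: sort_sorted.
by move=> a b; exact: ge_total.
Qed.

(** Exactly one permutation sorts the distinct entries of [y].  If the entries
    before position [l] are those greater than [x], they form an initial segment
    of the same size after sorting, so this permutation preserves the positions
    below [l]; otherwise no permutation preserving them fits around [x]. *)
Lemma card_sorting_perm :
  #|[set p in ('N(below_ord n l | 'P))%g |
      decreasing_tuple (insert_tuple l x (perm_tuple p y))]%SET| =
  [forall j : 'I_n, if (j < l)%N then x <= tnth y j else tnth y j <= x].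
Proof.
have ln : (l <= n)%N by rewrite -ltnS.
have NE p : (p \in ('N(below_ord n l | 'P))%g) = [forall j, (p j < l)%N == (j < l)%N].
  apply/idP/forallP => [sU j|sU].
    by have := astabs_act j sU; rewrite /= apermE !inE => ->.
  by apply/astabsP => j; rewrite /= apermE !inE; have /eqP := sU j.
set J := (X in _ = nat_of_bool X).
have [/forallP yJ|yJ] := boolP J; last first.
  apply/eqP; rewrite cards_eq0; apply: contraNT yJ => /set0Pn[p].
  rewrite inE NE decreasing_insert_perm => /and3P[/forallP pN _ /forallP pJ].
  apply/forallP => j; have := pJ (p^-1 j)%g; rewrite permKV.
  by have /eqP := pN (p^-1 j)%g; rewrite permKV => ->.
have [p pdec] := decreasing_perm_exists.
have lt_xy j : (x < tnth y j) = (j < l)%N.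
  have := yJ j; case: ifPn => jl; first by rewrite lt_neqAle eq_sym neq_xy.
  by rewrite ltNge => ->.
have pN : [forall j, (p j < l)%N == (j < l)%N].
  (* [S] is an initial segment of the same size as [below_ord n l]. *)
  pose S := [set j | x < tnth y (p j)]%SET.
  have SE : S = p @^-1: below_ord n l by apply/setP => j; rewrite !inE lt_xy.
  have cS : #|S| = l.
    by rewrite SE card_preimset ?card_below_ord//; exact: perm_inj.
  have : S = below_ord n l.
    apply/eqP; rewrite eqEcard cS card_below_ord// leqnn andbT.
    apply/fintype.subsetP => j; rewrite !inE => jS.
    rewrite -cS -[X in (X <= _)%N](@card_below_ord n j.+1)//.
    apply/subset_leq_card/fintype.subsetP => i; rewrite !inE ltnS => ij.
    apply: lt_le_trans jS _; move/decreasing_tupleP : pdec => /(_ _ _ ij).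
    by rewrite !tnth_mktuple.
  move=> /setP SA; apply/forallP => j; have := SA j.
  by rewrite SE !inE => ->.
rewrite (_ : finset _ = [set p]%SET) ?cards1//.
apply/setP => r; rewrite inE NE decreasing_insert_perm [RHS]inE.
apply/and3P/eqP => [[_ rdec _]|->]; first exact: decreasing_perm_uniq.
split => //; apply/forallP => j; have := yJ (p j).
by move/forallP : pN => /(_ j)/eqP ->.
Qed.

End count_sorting.

(** * Expectation through a density *)

(** The function [psi] itself may fail to be measurable.  It is replaced by
    [psi * g * g^-1], which is measurable, agrees with [psi] where [g] does not
    vanish, hence almost surely along [X], and has the same product with [g].
    The density [g] is a Radon-Nikodym derivative of the law of [X]. *)
Lemma expectation_density d d' (T : measurableType d) (T' : measurableType d')
    (R : realType) (P : probability T R)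
    (mu : {sigma_finite_measure set T' -> \bar R}) (X : {RV P >-> T'})
    (g psi : T' -> R) :
  measurable_fun setT g -> (forall x, 0 <= g x) ->
  (forall B, measurable B -> P (X @^-1` B) = (\int[mu]_(x in B) (g x)%:E)%E) ->
  P.-integrable setT (EFin \o (psi \o X)) ->
  measurable_fun setT (fun x => psi x * g x) ->
  (\int[P]_w (psi (X w))%:E = \int[mu]_x (psi x * g x)%:E)%E.
Proof.
move=> mg g0 Xg psiX mpsig.
pose psi' x := psi x * g x * (g x)^-1.
have mpsi' : measurable_fun setT psi'.
  apply: measurable_funM => //.
    (* A real power, because it is measurable; it takes the value 0 at 0, like
     the inverse. *)
rewrite (_ : (fun x => (g x)^-1) = (fun y => y `^ (-1)) \o g).
    exact: measurableT_comp.
  by apply/funext => x /=; rewrite powR_inv1.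
have mEg : measurable_fun setT (EFin \o g) by exact/measurable_EFinP.
have mg0 : measurable (g @^-1` [set 0]).
  by rewrite -[X in measurable X]setTI; exact: mg.
have psi'X : ae_eq P setT (EFin \o (psi \o X)) (EFin \o (psi' \o X)).
  exists (X @^-1` (g @^-1` [set 0])); split.
  - by rewrite -[X in measurable X]setTI; exact: (measurable_funPT X).
  - apply: (etrans (Xg _ mg0)).
    by apply: integral0_eq => x /= ->.
  - move=> w /= /not_implyP[_]; apply: contra_notP => gX.
    by rewrite /psi' mulfK//; exact/eqP.
pose nu := distribution P X.
have numu : nu `<< mu.
  move=> A muA B mB BA; apply: (etrans (Xg _ mB)).
  by apply: null_set_integral => //; [exact: measurable_funTS|exact: muA].
have RN : ae_eq mu setT (Radon_Nikodym (charge_of_finite_measure nu) mu) (EFin \o g).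
  apply: integral_ae_eq => //.
    exact: Radon_Nikodym_integrable.
  by move=> A _ mA; rewrite -Radon_Nikodym_integral//; exact: Xg.
have mpX : measurable_fun setT (EFin \o (psi' \o X)).
  by apply/measurable_EFinP; exact: measurableT_comp.
have ipX : P.-integrable setT (EFin \o (psi' \o X)).
  apply/integrableP; split => //.
  have /integrableP[mpsiX] := psiX; congr (_ < _)%E.
  apply: ae_eq_integral => //; [exact: measurableT_comp..|].
  exact: ae_eq_abse.
transitivity (\int[P]_w (EFin \o (psi' \o X)) w)%E.
  by apply: ae_eq_integral => //; exact: measurable_int psiX.
transitivity (\int[nu]_x (psi' x)%:E)%E.
  rewrite integral_distribution//; exact/measurable_EFinP.
rewrite -(Radon_Nikodym_change_of_variables numu measurableT); last first.
  by apply: integrable_pushforward => //; exact/measurable_EFinP.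
transitivity (\int[mu]_x ((psi' x)%:E * (g x)%:E))%E.
  apply: ae_eq_integral => //.
  - apply: emeasurable_funM; first exact/measurable_EFinP.
    exact: measurable_int (Radon_Nikodym_integrable _).
  - by apply: emeasurable_funM => //; exact/measurable_EFinP.
  - exact: ae_eqe_mul2l.
apply: eq_integral => x _; rewrite -EFinM /psi'.
have [->|gx] := eqVneq (g x) 0; first by rewrite !mulr0.
by rewrite mulfVK.
Qed.

(** * Integrating the pair of determinants over a slice *)

Section alternating_sums.
Context d (T : measurableType d) (R : realType) (N : nat).
Variables (mu : {measure set T -> \bar R}) (D : set T) (t : 'S_N -> 'S_N -> T -> R[i]).
Hypotheses (mD : measurable D) (ti : forall s r, cintegrable mu D (t s r)).

Let inner_cintegrable (s : 'S_N) :
  cintegrable mu D (fun x => \sum_(r : 'S_N) (-1) ^+ r * t s r x).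
Proof. by apply: cintegrable_sum => // r _; exact: cintegrableZl. Qed.

Lemma cintegrable_alternating :
  cintegrable mu D (fun x => \sum_(s : 'S_N) (-1) ^+ s *
    \sum_(r : 'S_N) (-1) ^+ r * t s r x).
Proof. by apply: cintegrable_sum => // s _; exact: cintegrableZl. Qed.

Lemma cintegral_alternating :
  cintegral mu D (fun x => \sum_(s : 'S_N) (-1) ^+ s *
    \sum_(r : 'S_N) (-1) ^+ r * t s r x) =
  \sum_(s : 'S_N) (-1) ^+ s * \sum_(r : 'S_N) (-1) ^+ r * cintegral mu D (t s r).
Proof.
rewrite cintegral_sum//; last by move=> s _; exact: cintegrableZl.
apply: eq_bigr => s _; rewrite cintegralZl// cintegral_sum//; last first.
  by move=> r _; exact: cintegrableZl.
by congr (_ * _); apply: eq_bigr => r _; rewrite cintegralZl.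
Qed.

End alternating_sums.

Lemma measurable_interval_between (R : realType) (a b : \bar R) :
  measurable (interval_between a b : set R).
Proof.
rewrite (_ : interval_between a b =
    (setT `&` [set x | a <= x%:E]%E) `&` (setT `&` [set x | x%:E <= b]%E)).
  apply: measurableI.
    by apply: emeasurable_fun_c_infty => //; exact: EFin_measurable.
  by apply: emeasurable_fun_infty_c => //; exact: EFin_measurable.
by apply/seteqP; split => x /= => [/andP[]|[[_ ax] [_ xb]]] //; apply/andP.
Qed.

Section slice.
Variables (R : realType) (n q : nat).
Let M := n.+1.
Let N := (n.+1 + q)%N.
Variables (Phi : 'I_M -> R -> R[i]) (Psi : 'I_N -> R -> R[i]).
Variables (Psibar : 'I_N -> 'I_N -> R[i]) (xi : R -> R[i]) (K : R[i]).
Variables (alpha beta : \bar R) (l : 'I_M).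

(** Up to the constant [K], the joint density of the ordered variables, written
    as a product of two determinants of the same size [N]. *)
Definition det_pair (x : M.-tuple R) : R[i] :=
  \det (Psi_mx (varsigma (N := N) Phi xi) (fun i k => (k <= i)%:R) x) *
  \det (Psi_mx Psi Psibar x).

(** Indices of the other variables skip [l], so that the [j]-th of them comes
    before the [l]-th variable exactly when [j < l]. *)
Definition slice_box (x : R) (j : 'I_n) : set R :=
  if (j < l)%N then interval_between x%:E beta else interval_between alpha x%:E.

Lemma measurable_slice_box x j : measurable (slice_box x j).
Proof. by rewrite /slice_box; case: ifP => _; exact: measurable_interval_between. Qed.

Lemma det_pair_perm (p : 'S_M) x : det_pair (perm_tuple p x) = det_pair x.
Proof. exact: det_Psi_mx2_perm. Qed.

Lemma det_pair_tie x : ~ injective (tnth x) -> det_pair x = 0.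
Proof.
move=> /injectiveP/injectivePn[i [j ij xij]].
by rewrite /det_pair (det_Psi_mx_tie _ _ ij xij) mul0r.
Qed.

Variable x : R.
Hypothesis upper : (0 < l)%N -> forall i j : 'I_N,
  cintegrable lebesgue_measure (interval_between x%:E beta)
    (fun y => varsigma Phi xi i y * Psi j y).
Hypothesis lower : (l < n)%N -> forall i j : 'I_N,
  cintegrable lebesgue_measure (interval_between alpha x%:E)
    (fun y => varsigma Phi xi i y * Psi j y).

Let A := A_tensor Phi Psi Psibar xi alpha beta l x.
Let tensor (y : n.-tuple R) : tensor3 R[i] N := fun i j k =>
  Psi_mx (varsigma (N := N) Phi xi) (fun i k => (k <= i)%:R) (insert_tuple l x y) i k *
  Psi_mx Psi Psibar (insert_tuple l x y) j k.

(** The columns other than the first [M] and the column [l] itself are constant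
    in [y]; every remaining column depends on a single entry of [y]. *)
Lemma cintegral_slice_term (mu al : 'S_N) :
  cintegrable (lebesgue_tuple R n) (box (slice_box x))
    (fun y => \prod_(k < N) tensor y (mu k) (al k) k) /\
  cintegral (lebesgue_tuple R n) (box (slice_box x))
    (fun y => \prod_(k < N) tensor y (mu k) (al k) k) =
  \prod_(k < N) A (mu k) (al k) k.
Proof.
pose u (j : 'I_n) (z : R) := let k := lshift q (lift l j) in
  varsigma Phi xi (mu k) z * Psi (al k) z.
(* The factors that do not depend on [y]: the column [l] and the constant
   columns. *)
pose c := A (mu (lshift q l)) (al (lshift q l)) (lshift q l) *
  \prod_(k < q) A (mu (rshift M k)) (al (rshift M k)) (rshift M k).
have iu j : cintegrable lebesgue_measure (slice_box x j) (u j).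
  rewrite /slice_box; case: ifPn => jl; first by apply: upper; exact: leq_trans jl.
  by apply: lower; rewrite (leq_ltn_trans _ (ltn_ord j))// leqNgt.
have mB : measurable (box (slice_box x)).
  by apply: measurable_box => j; exact: measurable_slice_box.
have [ib eb] := cintegral_box_prod (measurable_slice_box x) iu.
have tE y : \prod_(k < N) tensor y (mu k) (al k) k = c * \prod_(j < n) u j (tnth y j).
  rewrite big_split_ord (bigD1_ord l)//= -mulrA [X in _ * X]mulrC mulrA; congr (_ * _ * _).
  - by rewrite /tensor !Psi_mx_lshift tnth_insert /A /A_tensor /= ltn_ord ltnn eqxx.
  - apply: eq_bigr => k _; rewrite /tensor !Psi_mx_rshift /A /A_tensor /=.
    rewrite ltnNge leq_addr /= ltnNge.
    by case: leqP; rewrite ?mul1r ?mul0r.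
  - by apply: eq_bigr => j _; rewrite /tensor !Psi_mx_lshift tnth_insert_lift.
have AE : \prod_(k < N) A (mu k) (al k) k =
    c * \prod_(j < n) cintegral lebesgue_measure (slice_box x j) (u j).
  rewrite big_split_ord (bigD1_ord l)//= -mulrA [X in _ * X]mulrC mulrA; congr (_ * _).
  apply: eq_bigr => j _.
  have kM : (lshift q (lift l j) < M)%N by exact: (ltn_ord (lift l j)).
  have kl : (lshift q (lift l j) < l)%N = (j < l)%N.
    by rewrite /= /bump; case: (leqP l j) => // lj; rewrite ltnNge ltnW// ltnS.
  have knl : (lshift q (lift l j) == l :> nat) = false.
    by rewrite eq_sym; exact/negbTE/neq_lift.
  by rewrite /A /A_tensor kM kl knl /slice_box /u; case: ifP.
split.
  by apply: (eq_cintegrable mB (fun y _ => esym (tE y))); exact: cintegrableZl.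
by rewrite (eq_cintegral _ (fun y _ => tE y)) cintegralZl// eb AE.
Qed.

Lemma cintegral_slice :
  cintegrable (lebesgue_tuple R n) (box (slice_box x))
    (fun y => det_pair (insert_tuple l x y)) /\
  cintegral (lebesgue_tuple R n) (box (slice_box x))
    (fun y => det_pair (insert_tuple l x y)) = pseudo_det A.
Proof.
have mB : measurable (box (slice_box x)).
  by apply: measurable_box => j; exact: measurable_slice_box.
have E y : det_pair (insert_tuple l x y) = pseudo_det (tensor y).
  by rewrite pseudo_det_mul.
have ti mu al := (cintegral_slice_term mu al).1.
split.
  apply: (eq_cintegrable mB (fun y _ => esym (E y))).
  exact: cintegrable_alternating.
rewrite (eq_cintegral _ (fun y _ => E y)) cintegral_alternating//.
apply: eq_bigr => mu _; congr (_ * _); apply: eq_bigr => al _; congr (_ * _).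
exact: (cintegral_slice_term mu al).2.
Qed.

End slice.

(** * The marginal density *)

Lemma ordered_regionE (R : realType) (a b : \bar R) n (x : n.-tuple R) :
  ordered_region a b x <->
  (forall i, interval_between a b (tnth x i)) /\ decreasing_tuple x.
Proof. by split=> -[h1 h2]; split => //; exact/decreasing_tupleP. Qed.

Lemma measurable_ordered_region (R : realType) (a b : \bar R) n :
  measurable (@ordered_region R a b n).
Proof.
rewrite (_ : @ordered_region R a b n = box (fun _ : 'I_n => interval_between a b) `&`
  \bigcap_(i in [set: 'I_n]) \bigcap_(j in [set: 'I_n])
    (if (i <= j)%N then [set x : n.-tuple R | tnth x j <= tnth x i] else setT)).
  apply: measurableI.
    by apply: measurable_box => i; exact: measurable_interval_between.
  apply: fin_bigcap_measurable => // i _; apply: fin_bigcap_measurable => // j _.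
  case: ifP => _; last exact: measurableT.
  rewrite -[X in measurable X]setTI.
  by apply: measurable_fun_le => //; exact: measurable_tnth.
apply/seteqP; split => [x [xab xd]|x [xab xd]]; split => //.
  by move=> i _ j _; case: ifP => // ij; exact: xd.
by move=> i j ij; have := xd i I j I; rewrite ij.
Qed.

Section slice_density.
Variables (R : realType) (n q : nat).
Let M := n.+1.
Let N := (n.+1 + q)%N.
Variables (Phi : 'I_M -> R -> R[i]) (Psi : 'I_N -> R -> R[i]).
Variables (Psibar : 'I_N -> 'I_N -> R[i]) (xi : R -> R[i]) (K : R[i]).
Variables (alpha beta : \bar R) (l : 'I_M) (f : M.-tuple R -> R).

Let D := @ordered_region R alpha beta M.
Let F := det_pair Phi Psi Psibar xi.

Hypothesis mf : measurable_fun D f.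
Hypothesis f0 : forall x, D x -> 0 <= f x.
Hypothesis fF : forall x, D x -> (f x)%:C = K * F x.

Let mD : measurable D. Proof. exact: measurable_ordered_region. Qed.

Let mfD : measurable_fun setT (EFin \o (f \_ D)).
Proof.
by apply/measurable_EFinP; apply/(measurable_restrictT f mD).
Qed.

Let fD0 x : 0 <= (f \_ D) x.
Proof. by rewrite patchE; case: ifPn => // /set_mem /f0. Qed.

Variable x : R.
Hypothesis xab : (alpha < x%:E < beta)%E.

(** The value of the density is the same at all the reorderings of [y], so the
    sum counts the reorderings that are sorted: one on the box and none outside,
    unless there is a tie, and then [det_pair] is zero.  The identity holds at
    every point, which makes null sets of ties irrelevant. *)
Lemma sum_ordered_slice (y : n.-tuple R) :
  \sum_(p in ('N(below_ord n l | 'P))%g) ((f \_ D) (insert_tuple l x (perm_tuple p y)))%:C =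
  if y \in box (slice_box alpha beta l x) then K * F (insert_tuple l x y) else 0.
Proof.
have Fp p : F (insert_tuple l x (perm_tuple p y)) = F (insert_tuple l x y).
  by rewrite insert_perm_tuple; exact: det_pair_perm.
have termE p : ((f \_ D) (insert_tuple l x (perm_tuple p y)))%:C =
    if `[< D (insert_tuple l x (perm_tuple p y)) >] then K * F (insert_tuple l x y) else 0.
  rewrite patchE; case: ifPn => [/set_mem Dp|/negP nDp].
    by rewrite asboolT// fF// Fp.
  by rewrite asboolF// => Dp; apply: nDp; exact: mem_set.
under eq_bigr do rewrite termE.
have [inj|/det_pair_tie F0] := pselect (injective (tnth (insert_tuple l x y))); last first.
  by rewrite /F F0 mulr0 if_same big1// => p _; rewrite if_same.
have [yab|yab] := pselect (forall j, interval_between alpha beta (tnth y j)).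
- have DE p : `[< D (insert_tuple l x (perm_tuple p y)) >] =
      decreasing_tuple (insert_tuple l x (perm_tuple p y)).
    apply/asboolP/idP => [/ordered_regionE[]//|dec]; apply/ordered_regionE; split => // i.
    case: (unliftP l i) => [j ->|->].
      by rewrite tnth_insert_lift tnth_mktuple.
    by rewrite tnth_insert; case/andP: xab => ax xb; apply/andP; rewrite !ltW.
  under eq_bigr do rewrite DE.
  rewrite -big_mkcondr sumr_const -cardsE /=.
  have -> : [set p | (p \in ('N(below_ord n l | 'P))%g) &&
      decreasing_tuple (insert_tuple l x (perm_tuple p y))]%SET =
      [set p in ('N(below_ord n l | 'P))%g |
       decreasing_tuple (insert_tuple l x (perm_tuple p y))]%SET by [].
  rewrite (card_sorting_perm inj).
  have -> : (y \in box (slice_box alpha beta l x)) =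
      [forall j : 'I_n, if (j < l)%N then x <= tnth y j else tnth y j <= x].
    apply/idP/forallP => [/set_mem yJ j|yJ].
      have := yJ j; rewrite /slice_box; case: ifP => _ /andP[];
        by rewrite ?lee_fin.
    apply/mem_set => j; have := yJ j; have /andP[ayj yjb] := yab j.
    rewrite /slice_box; case: ifP => _ yx; apply/andP; split; by rewrite ?lee_fin.
  by case: ifP.
- rewrite big1; last first.
    move=> p _; rewrite asboolF// => /ordered_regionE[zab _]; apply: yab => j.
    have := zab (lift l ((p^-1)%g j)).
    by rewrite tnth_insert_lift tnth_mktuple permKV.
  rewrite memNset// => yJ; apply: yab => j; have := yJ j.
  case/andP: xab => ax xb.
  rewrite /slice_box; case: ifP => _ /andP[h1 h2]; apply/andP; split => //.
    by apply: le_trans h1; exact: ltW.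
  by apply: (le_trans h2); exact: ltW.
Qed.

Hypothesis upper : (0 < l)%N -> forall i j : 'I_N,
  cintegrable lebesgue_measure (interval_between x%:E beta)
    (fun y => varsigma Phi xi i y * Psi j y).
Hypothesis lower : (l < n)%N -> forall i j : 'I_N,
  cintegrable lebesgue_measure (interval_between alpha x%:E)
    (fun y => varsigma Phi xi i y * Psi j y).

(** Integrate [sum_ordered_slice]: by invariance of the measure all the terms of
    the sum have the same integral, so the slice integral is the integral over
    the box divided by the number of permutations.  The right-hand side is real
    because the density is. *)
Lemma slice_density : exists2 r : R, 
  (\int[lebesgue_tuple R n]_y ((f \_ D) (insert_tuple l x y))%:E = r%:E)%E &
  r%:C = ((l`! * (n - l)`!)%N%:R)^-1 * K *
    pseudo_det (A_tensor Phi Psi Psibar xi alpha beta l x).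
Proof.
pose S y := (f \_ D) (insert_tuple l x y).
have mS : measurable_fun setT (EFin \o S).
  exact: (measurableT_comp mfD (measurable_insert l x)).
pose G := ('N(below_ord n l | 'P))%g.
have cG : #|G| = (l`! * (n - l)`!)%N.
  have ln : (l <= n)%N by rewrite -ltnS.
  have cC : #|~: below_ord n l| = (n - l)%N.
    by rewrite cardsCs finset.setCK card_below_ord// card_ord.
  by rewrite card_astabs_perm cC card_below_ord.
have mB : measurable (box (slice_box alpha beta l x)).
  by apply: measurable_box => j; exact: measurable_slice_box.
have [iF eF] := @cintegral_slice R n q Phi Psi Psibar xi alpha beta l x upper lower.
have [iKF1 iKF2] := cintegrableZl mB K iF.
have := cintegralZl mB K iF; rewrite eF {eF}.
set B := box _ in mB iF iKF1 iKF2 *.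
set KF := fun y => K * det_pair Phi Psi Psibar xi (insert_tuple l x y).
have sumE y : (\sum_(p in G) S (perm_tuple p y))%:C = if y \in B then KF y else 0.
  by rewrite rmorph_sum; exact: sum_ordered_slice.
have KF_Re y : y \in B -> complex.Re (KF y) = \sum_(p in G) S (perm_tuple p y).
  by move=> yB; have := sumE y; rewrite yB => <-.
have KF_Im y : y \in B -> complex.Im (KF y) = 0.
  by move=> yB; have := sumE y; rewrite yB => <-.
rewrite /cintegral.
under [X in _ +i* X]eq_Rintegral => y yB do rewrite KF_Im//.
rewrite Rintegral_cst// mul0r => KT.
exists ((#|G|%:R)^-1 * \int[lebesgue_tuple R n]_(y in B) complex.Re (KF y)).
  set I := (\int[_]_y _)%E.
  have cI : (#|G|%:R%:E * I = (\int[lebesgue_tuple R n]_(y in B) complex.Re (KF y))%:E)%E.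
    rewrite /Rintegral fineK; last exact: integrable_fin_num.
    transitivity (\sum_(p in G) \int[lebesgue_tuple R n]_y (S (perm_tuple p y))%:E)%E.
      rewrite -sum1_card natr_sum -sumEFin ge0_sume_distrl//; apply: eq_bigr => p _.
      rewrite mul1e; apply/esym.
      exact: (ge0_integral_perm_tuple p mS (fun y => fD0 _)).
    rewrite -big_enum -ge0_integral_sum//; first last.
      by move=> p y _; exact: fD0.
      by move=> p; exact: (measurableT_comp mS (measurable_perm_tuple _)).
    under eq_integral do rewrite big_enum.
    rewrite [RHS]integral_mkcond; apply: eq_integral => y _.
    rewrite sumEFin patchE; case: ifPn => yB; first by rewrite /= KF_Re.
    by have := sumE y; rewrite (negbTE yB) => /(congr1 (@complex.Re R)) /= ->.
  have G0 : 0 < #|G|%:R :> R by rewrite ltr0n cardG_gt0.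
  have I0 : (0 <= I)%E by apply: integral_ge0 => y _; exact: fD0.
  move: I0 cI; case: I => [r _ [<-]|_|//].
    by rewrite mulKf ?gt_eqF.
  by rewrite gt0_muley ?lte_fin.
by rewrite -cG -mulrA -KT rmorphM fmorphV rmorph_nat.
Qed.

End slice_density.

(** * The law of one coordinate, and the theorem *)

Lemma marginal_law (R : realType) n d (T : measurableType d) (P : probability T R)
    (X : 'I_n.+1 -> {RV P >-> R}) (D : set (n.+1.-tuple R)) (f : n.+1.-tuple R -> R)
    (l : 'I_n.+1) (B : set (measurableTypeR R)) :
  measurable D -> is_joint_pdf_on P X D f -> measurable B ->
  P (X l @^-1` B) = (\int[lebesgue_measure]_(x in B)
    \int[lebesgue_tuple R n]_y ((f \_ D) (insert_tuple l x y))%:E)%E.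
Proof.
move=> mD [mf f0 fP] mB.
have mB' : measurable ((fun t : n.+1.-tuple R => tnth t l) @^-1` B).
  by apply: measurable_tnth_preimage; exact: mB.
transitivity (\int[lebesgue_tuple R n.+1]_(x in
    (fun t : n.+1.-tuple R => tnth t l) @^-1` B `&` D) (f x)%:E)%E.
  rewrite -fP//; congr (P _); apply/seteqP.
  by split => w /=; rewrite tnth_mktuple.
have mfD : measurable_fun setT (EFin \o (f \_ D)).
  by apply/measurable_EFinP; apply/(measurable_restrictT f mD).
have fD0 x : 0 <= (f \_ D) x by rewrite patchE; case: ifPn => // /set_mem /f0.
rewrite integral_mkcondr integral_mkcond (@ge0_integral_insert _ _ l); last 2 first.
- apply/(measurable_restrictT _ mB'); apply: measurable_funTS.
  by rewrite restrict_EFin.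
- move=> x; rewrite restrict_EFin patchE; case: ifP => // _.
  by rewrite lee_fin fD0.
rewrite [RHS]integral_mkcond; apply: eq_integral => x _.
rewrite patchE restrict_EFin; case: ifPn => xB.
  apply: eq_integral => y _; rewrite patchE mem_set//= tnth_insert.
  exact: set_mem.
rewrite integral0_eq// => y _; rewrite patchE memNset//= tnth_insert => /mem_set.
exact/negP.
Qed.

Lemma null_EFin_preimage1 (R : realType) (a : \bar R) :
  measurable (EFin @^-1` [set a] : set (measurableTypeR R)) /\
  lebesgue_measure (EFin @^-1` [set a] : set (measurableTypeR R)) = 0%E.
Proof.
case: a => [r| |].
- rewrite (_ : _ @^-1` _ = [set r]).
    by split; [exact: measurable_set1|exact: lebesgue_measure_set1].
  by apply/seteqP; split => x /=; [case|move=> ->].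
- by rewrite (_ : _ @^-1` _ = set0) ?measure0; [split|rewrite -subset0 => x].
- by rewrite (_ : _ @^-1` _ = set0) ?measure0; [split|rewrite -subset0 => x].
Qed.

(** The density formula is only available strictly between [alpha] and [beta],
    whereas the integrals of the theorem include the endpoints. *)
Lemma null_endpoints (R : realType) (a b : \bar R) :
  exists2 Z : set (measurableTypeR R), measurable Z /\ lebesgue_measure Z = 0%E &
    forall x, ~ Z x -> interval_between a b x -> (a < x%:E < b)%E.
Proof.
have [ma a0] := null_EFin_preimage1 a; have [mb b0] := null_EFin_preimage1 b.
exists (EFin @^-1` [set a] `|` EFin @^-1` [set b]).
  by split; [exact: measurableU|exact: null_set_setU].
move=> x /not_orP[/= xa xb] /andP[ax bx]; rewrite !lt_neqAle ax bx !andbT.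
by apply/andP; split; apply/eqP => // /esym.
Qed.

Theorem theorem4p1 (R : realType) (M N : nat) (hM : (1 <= M)%N)
  (hMN : (M <= N)%N) (alpha beta : \bar R) (hab : (alpha < beta)%E)
  (Phi : 'I_M -> R -> R[i]) (Psi : 'I_N -> R -> R[i])
  (Psibar : 'I_N -> 'I_N -> R[i]) (xi : R -> R[i]) (K : R[i])
  (d : measure_display) (Omega : measurableType d) (P : probability Omega R)
  (lambda : 'I_M -> {RV P >-> R})
  (hord : {ae P, forall w,
     ordered_region alpha beta [tuple lambda i w | i < M]})
  (f : M.-tuple R -> R)
  (hpdf : is_joint_pdf_on P lambda (@ordered_region R alpha beta M) f)
  (hf : forall x : M.-tuple R, ordered_region alpha beta x ->
     (f x)%:C = K * \det (Phi_mx Phi x) * \det (Psi_mx Psi Psibar x) *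
                \prod_(i < M) xi (tnth x i))
  (l : 'I_M) (phi : R -> R[i])
  (hupper : (0 < l)%N -> forall x : R, (alpha < x%:E < beta)%E ->
     forall i j : 'I_N,
       cintegrable lebesgue_measure (interval_between x%:E beta)
         (fun y => varsigma Phi xi i y * Psi j y))
  (hlower : (l.+1 < M)%N -> forall x : R, (alpha < x%:E < beta)%E ->
     forall i j : 'I_N,
       cintegrable lebesgue_measure (interval_between alpha x%:E)
         (fun y => varsigma Phi xi i y * Psi j y))
  (hterm : forall mu al : 'S_N,
     cintegrable lebesgue_measure (interval_between alpha beta)
       (fun x => phi x * \prod_(k < N)
          A_tensor Phi Psi Psibar xi alpha beta l x (mu k) (al k) k))
  (hexp : cintegrable P setT (fun w => phi (lambda l w))) :
  let A := A_tensor Phi Psi Psibar xi alpha beta l in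
  let I := cintegral lebesgue_measure (interval_between alpha beta)
             (fun x => phi x * pseudo_det (A x)) in
  cexpectation P (fun w => phi (lambda l w)) =
    ((l`! * (M - l.+1)`!)%N%:R)^-1 * K * I /\
  I = \sum_(mu : 'S_N) (-1) ^+ mu * \sum_(al : 'S_N) (-1) ^+ al *
        cintegral lebesgue_measure (interval_between alpha beta)
          (fun x => phi x * \prod_(k < N) A x (mu k) (al k) k).
Proof.
move=> A I.
set J : set (measurableTypeR R) := interval_between alpha beta.
have mJ : measurable J by exact: measurable_interval_between.
have AE x : phi x * pseudo_det (A x) = \sum_(mu : 'S_N) (-1) ^+ mu *
    \sum_(al : 'S_N) (-1) ^+ al * (phi x * \prod_(k < N) A x (mu k) (al k) k).
  rewrite mulr_sumr; apply: eq_bigr => mu _; rewrite mulrCA; congr (_ * _).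
  by rewrite mulr_sumr; apply: eq_bigr => al _; rewrite mulrCA.
split; last first.
  rewrite /I (eq_cintegral lebesgue_measure (D := J) (fun x _ => AE x)).
  by rewrite cintegral_alternating.
have iI : cintegrable lebesgue_measure J (fun x => phi x * pseudo_det (A x)).
  apply: (eq_cintegrable mJ (fun x _ => esym (AE x))).
  exact: cintegrable_alternating.
move: M hM hMN Phi lambda hord f hpdf hf l hupper hlower hterm hexp @A @I AE iI.
case=> // n _ hMN Phi lambda _ f hpdf hf l hupper hlower _ hexp A I _ iI.
have [q qE] : exists q, N = (n.+1 + q)%N by exists (N - n.+1)%N; rewrite subnKC.
subst N.
pose D := @ordered_region R alpha beta n.+1.
have mD : measurable D by exact: measurable_ordered_region.
have [mf f0 _] := hpdf.
have fF x : D x -> (f x)%:C = K * det_pair Phi Psi Psibar xi x.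
  move=> /hf ->; rewrite /det_pair det_varsigma_mx.
  by rewrite -!mulrA; congr (_ * (_ * _)); rewrite mulrC.
pose c := ((l`! * (n.+1 - l.+1)`!)%N%:R)^-1 * K.
pose w x := c * (phi x * pseudo_det (A x)).
have iw : cintegrable lebesgue_measure J w by exact: cintegrableZl.
rewrite -[RHS](cintegralZl mJ c iI).
pose H x := (\int[lebesgue_tuple R n]_y ((f \_ D) (insert_tuple l x y))%:E)%E.
pose E : set (measurableTypeR R) := [set x | alpha < x%:E < beta]%E.
have HE x : E x -> exists2 r, H x = r%:E & r%:C = c * pseudo_det (A x).
  move=> xE; apply: slice_density => //.
  - by move=> l0; exact: hupper.
  - by move=> ln; exact: hlower.
have EJ : E `<=` J by move=> x /andP[ax xb]; apply/andP; rewrite !ltW.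
have mE : measurable E.
  rewrite (_ : E = (setT `&` [set x | alpha < x%:E]%E) `&`
                   (setT `&` [set x | x%:E < beta]%E)).
    apply: measurableI.
      by apply: emeasurable_fun_o_infty => //; exact: EFin_measurable.
    by apply: emeasurable_fun_infty_o => //; exact: EFin_measurable.
  by apply/seteqP; split => x /= => [/andP[]|[[_ ax] [_ xb]]] //; apply/andP.
have fD0 x : 0 <= (f \_ D) x by rewrite patchE; case: ifPn => // /set_mem /f0.
have H0 x : (0 <= H x)%E by apply: integral_ge0 => y _; rewrite lee_fin.
have H_out x : ~ J x -> H x = 0%E.
  move=> nJ; apply: integral0_eq => y _; rewrite patchE memNset//.
  by move=> /ordered_regionE[/(_ l)]; rewrite tnth_insert.
have mH : measurable_fun [set: measurableTypeR R] H.
  apply: (@measurable_integral_insert _ _ l (EFin \o (f \_ D))).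
    by apply/measurable_EFinP; apply/(measurable_restrictT f mD).
  by move=> x; rewrite /= lee_fin.
(* A version of the marginal density that is finite everywhere; it vanishes
   outside the open interval. *)
pose g : measurableTypeR R -> R := (fun x => fine (H x)) \_ E.
have mg : measurable_fun setT g.
  apply/(measurable_restrictT _ mE); apply: measurable_funTS.
  exact: (measurableT_comp (fine_measurable measurableT) mH).
have g0 x : 0 <= g x by rewrite /g patchE; case: ifP => // _; exact: fine_ge0.
have gE x : E x -> H x = (g x)%:E /\ (g x)%:C = c * pseudo_det (A x).
  by move=> xE; rewrite /g patchE mem_set//; have [r -> <-] := HE _ xE.
have g_out x : ~ E x -> g x = 0 by move=> xE; rewrite /g patchE memNset.
have [Z [mZ Z0] JZ] := null_endpoints alpha beta.
have mX : measurable_fun setT (lambda l : Omega -> measurableTypeR R).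
  by move=> mT B mB; exact: (measurable_funPT (lambda l) mT B mB).
pose X : {RV P >-> measurableTypeR R} :=
  HB.pack (lambda l : Omega -> measurableTypeR R)
    (isMeasurableFun.Build _ _ _ _ _ mX).
have law B : measurable B -> P (X @^-1` B) =
    (\int[lebesgue_measure]_(x in B) (g x)%:E)%E.
  move=> mB; rewrite [LHS](marginal_law l mD hpdf mB).
  apply: ae_eq_integral => //.
  - exact: measurable_funTS.
  - by apply: measurable_funTS; exact/measurable_EFinP.
  exists Z; split => // x /= /not_implyP[_]; apply: contra_notP => nZ.
  have [xJ|nJ] := pselect (J x); first exact: (gE _ (JZ _ nZ xJ)).1.
  by rewrite g_out; [exact: H_out|move=> /EJ].
have key (p : R[i] -> R) : (forall r z, p (r%:C * z) = r * p z) ->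
    P.-integrable setT (EFin \o (fun o => p (phi (lambda l o)))) ->
    lebesgue_measure.-integrable J (EFin \o (fun x => p (w x))) ->
    fine ('E_P[fun o => p (phi (lambda l o))])%E =
    \int[lebesgue_measure]_(x in J) p (w x).
  move=> pM ipX ipw.
    (* [phi] times the density is measurable because it is [w] restricted
     to [E]. *)
have pgE : (fun x => p (phi x) * g x) = (fun x => p (w x)) \_ E.
    apply/funext => x; rewrite patchE; case: ifPn => [/set_mem xE|/negP xE].
      by rewrite /w mulrCA -(gE _ xE).2 mulrC -pM mulrC.
    by rewrite g_out ?mulr0// => /mem_set.
  have mpw : measurable_fun J (fun x => p (w x)).
    by apply/measurable_EFinP; exact: measurable_int ipw.
  have mpg : measurable_fun [set: measurableTypeR R] (fun x => p (phi x) * g x).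
    by rewrite pgE; apply/(measurable_restrictT _ mE); exact: measurable_funS mpw.
  rewrite unlock /Rintegral; congr fine.
  rewrite (expectation_density (X := X) (psi := fun x => p (phi x)) mg g0 law ipX mpg).
  rewrite [RHS]integral_mkcond; apply: ae_eq_integral => //.
  - exact/measurable_EFinP.
  - apply/(measurable_restrictT _ mJ); exact/measurable_EFinP.
  exists Z; split => // x /= /not_implyP[_]; apply: contra_notP => nZ.
  have /(congr1 (fun h => h x)) -> := pgE; rewrite !patchE.
  case: ifPn => xE; first by rewrite mem_set//; exact/EJ/set_mem.
  by rewrite memNset// => /(JZ _ nZ) /mem_set; exact/negP.
case: hexp => hexp1 hexp2; case: iw => iw1 iw2.
rewrite /cexpectation /cintegral; congr (_ +i* _).
  by apply: key => // r z; rewrite complexReM /= mul0r subr0.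
by apply: key => // r z; rewrite complexImM /= mul0r addr0.
Qed.
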